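(* On $\mathcal{H}=L^2(\mathbb{R})$, let $\mathsf{Q}$ and $\mathsf{P}$ be the canonical position and momentum observables with outcome space $\mathbb{R}$, given by $\langle\psi,\mathsf{Q}(X)\psi\rangle=\int_X|\psi(x)|^2\,dx$ and $\langle\psi,\mathsf{P}(Y)\psi\rangle=\int_Y|\widehat{\psi}(y)|^2\,dy$ for Borel sets $X,Y\subseteq\mathbb{R}$, where $\widehat\psi$ is the (unitary) Fourier transform of $\psi$. Then $\mathsf{Q}$ and $\mathsf{P}$ are maximally incompatible, i.e. $J(\mathsf{Q},\mathsf{P})=\{(\lambda,\mu)\in[0,1]^2:\lambda+\mu\leq 1\}$.
   Context: An observable on a Hilbert space $\mathcal{H}$ with outcome space $\Omega$ (a Borel subset of some $\mathbb{R}^n$) is a normalized positive operator valued measure (POVM) on the Borel sets of $\Omega$. An observable $\mathsf{T}$ is trivial if $\mathsf{T}(X)=\mu(X)I$ for some probability measure $\mu$. Two observables $\mathsf{M}_1,\mathsf{M}_2$ with outcome spaces $\Omega_1,\Omega_2$ are jointly measurable if there is an observable $\mathsf{M}$ on $\Omega_1\times\Omega_2$ with $\mathsf{M}(X\times\Omega_2)=\mathsf{M}_1(X)$ and $\mathsf{M}(\Omega_1\times Y)=\mathsf{M}_2(Y)$ for all Borel $X,Y$. The joint measurability region $J(\mathsf{M}_1,\mathsf{M}_2)$ is the set of $(\lambda,\mu)\in[0,1]\times[0,1]$ for which there exist trivial observables $\mathsf{T}_1$ on $\Omega_1$ and $\mathsf{T}_2$ on $\Omega_2$ such that $\lambda\mathsf{M}_1+(1-\lambda)\mathsf{T}_1$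 and $\mu\mathsf{M}_2+(1-\mu)\mathsf{T}_2$ are jointly measurable. A pair is maximally incompatible if its joint measurability region equals $\{(\lambda,\mu)\in[0,1]^2:\lambda+\mu\leq1\}$. *)

(* Defs.v *)
From HB Require Import structures.
From mathcomp Require Import all_boot all_order all_algebra.
From mathcomp Require Import all_classical all_reals all_analysis.
From mathcomp Require Import complex.
Set Implicit Arguments. Unset Strict Implicit. Unset Printing Implicit Defensive.
Import Order.TTheory GRing.Theory Num.Theory.
Import numFieldNormedType.Exports.
Local Open Scope classical_set_scope.
Local Open Scope ring_scope.
Local Open Scope complex_scope.

Section Observables.
Variable R : realType.
Local Notation C := R[i].
Local Notation mu := (@lebesgue_measure R).

Definition cre (z : C) : R := complex.Re z.
Definition cim (z : C) : R := complex.Im z.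
Definition cnorm2 (z : C) : R := cre z ^+ 2 + cim z ^+ 2.

(* "vectors" of L^2(R): measurable, square integrable complex functions
   (elements of the Hilbert space are their a.e.-classes) *)
Definition L2 (psi : R -> C) : Prop :=
  measurable_fun setT (cre \o psi) /\ measurable_fun setT (cim \o psi) /\
  (\int[mu]_x (cnorm2 (psi x))%:E < +oo)%E.

Definition aeq (f g : R -> C) : Prop := {ae mu, forall x, f x = g x}.

Definition cint (D : set R) (f : R -> C) : C :=
  (Rintegral mu D (cre \o f))%:C + 'i * (Rintegral mu D (cim \o f))%:C.

Definition inner (phi psi : R -> C) : C := cint setT (fun x => (phi x)^* * psi x).

(* (representatives of) operators on L^2(R) *)
Definition op := (R -> C) -> (R -> C).

Definition bounded_linear (A : op) : Prop :=
  (forall psi, L2 psi -> L2 (A psi)) /\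
  (forall psi phi, L2 psi -> L2 phi -> aeq psi phi -> aeq (A psi) (A phi)) /\
  (forall (a : C) psi phi, L2 psi -> L2 phi ->
     aeq (A (fun x => a * psi x + phi x)) (fun x => a * A psi x + A phi x)) /\
  (exists c : R, forall psi, L2 psi ->
     cre (inner (A psi) (A psi)) <= c * cre (inner psi psi)).

Definition positive_op (A : op) : Prop :=
  forall psi, L2 psi -> 0 <= inner psi (A psi).

Definition observable d (T : measurableType d) (M : set T -> op) : Prop :=
  (forall Z, measurable Z -> bounded_linear (M Z) /\ positive_op (M Z)) /\
  (forall psi, L2 psi -> aeq (M setT psi) psi) /\
  (forall Z : nat -> set T, (forall k, measurable (Z k)) -> trivIset setT Z ->
     forall psi, L2 psi ->
       (fun n => \sum_(k < n) cre (inner psi (M (Z k) psi))) @ \oo -->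
         cre (inner psi (M (\bigcup_k Z k) psi))).

Definition triv_obs d (T : measurableType d) (nu : probability T R) : set T -> op :=
  fun X psi x => (fine (nu X))%:C * psi x.

Definition mix d (T : measurableType d) (lam : R) (M1 M2 : set T -> op) : set T -> op :=
  fun X psi x => lam%:C * M1 X psi x + (1 - lam)%:C * M2 X psi x.

Definition jointly_measurable d1 d2 (T1 : measurableType d1) (T2 : measurableType d2)
    (M1 : set T1 -> op) (M2 : set T2 -> op) : Prop :=
  exists M : set (T1 * T2) -> op, observable M /\
    (forall X, measurable X -> forall psi, L2 psi ->
       aeq (M (X `*` setT) psi) (M1 X psi)) /\
    (forall Y, measurable Y -> forall psi, L2 psi ->
       aeq (M (setT `*` Y) psi) (M2 Y psi)).

Definition jm_region d1 d2 (T1 : measurableType d1) (T2 : measurableType d2)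
    (M1 : set T1 -> op) (M2 : set T2 -> op) : set (R * R) :=
  [set p | 0 <= p.1 <= 1 /\ 0 <= p.2 <= 1 /\
     exists (nu1 : probability T1 R) (nu2 : probability T2 R),
       jointly_measurable (mix p.1 M1 (triv_obs nu1)) (mix p.2 M2 (triv_obs nu2))].

Definition expi (t : R) : C := (cos t)%:C + 'i * (sin t)%:C.

Definition ftrunc (psi : R -> C) (n : nat) (y : R) : C :=
  (Num.sqrt (pi *+ 2))^-1%:C * cint `[(- n%:R), n%:R] (fun x => psi x * expi (- (x * y))).

(* phi is the unitary (Fourier-Plancherel) transform of psi: the L^2-limit
   of the truncated Fourier integrals *)
Definition is_fourier (psi phi : R -> C) : Prop :=
  L2 phi /\
  (fun n : nat => (\int[mu]_y (cnorm2 (phi y - ftrunc psi n y))%:E)%E) @ \oo --> 0%E.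

End Observables.

(* Main.v *)
Require Import Defs.
From HB Require Import structures.
From mathcomp Require Import all_boot all_order all_algebra.
From mathcomp Require Import all_classical all_reals all_analysis.
From mathcomp Require Import measurable_realfun.
From mathcomp Require Import complex ring lra.
Set Implicit Arguments. Unset Strict Implicit. Unset Printing Implicit Defensive.
Import Order.TTheory GRing.Theory Num.Theory.
Import numFieldNormedType.Exports.
Local Open Scope classical_set_scope.
Local Open Scope ring_scope.
Local Open Scope complex_scope.

(** Necessity: let [M] be a joint observable for the weights [lam] and [m], and put
    [X = [q, q + 1]], [Y = [p - b, p + b]].  Additivity of [M] gives
    [<M(X x R)> + <M(R x Y)> <= 1 + <M(X x Y)>] in every unit vector, so for the wave
    packet [psi = box q p] (a unit box in position, modulated by [p]) it suffices that
    [<psi, M(X x Y) psi>] is small.  Moving [q] and [p] far away makes the noise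
    probabilities of [X] and [Y] negligible, and then [M(X x Y)] is nearly dominated
    both by [Q(X)] and by [P(Y)].  Hence its quadratic form is small on translates of
    [psi] disjoint from [X], and also on vectors whose Fourier transform is small on
    [Y].  A superoscillating trigonometric polynomial approximates [psi^] on [Y] by
    combinations of Fourier transforms of such translates, i.e. writes [psi] as a sum
    of vectors of these two kinds, and the parallelogram law concludes.

    Sufficiency: put [lam Q] on the first axis of the plane, [m P] on the second
    axis, and the remaining weight at the origin. *)

(** * Real and imaginary parts of complex numbers *)

Section ComplexParts.
Variable R : realType.
Implicit Types (z w : R[i]) (r : R).

Lemma complex_ext z w : cre z = cre w -> cim z = cim w -> z = w.
Proof. by case: z w => [a b] [c d]; rewrite /cre /cim /= => -> ->. Qed.

Lemma creD z w : cre (z + w) = cre z + cre w.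
Proof. by case: z w => [a b] [c d]. Qed.

Lemma cimD z w : cim (z + w) = cim z + cim w.
Proof. by case: z w => [a b] [c d]. Qed.

Lemma creN z : cre (- z) = - cre z. Proof. by case: z. Qed.

Lemma cimN z : cim (- z) = - cim z. Proof. by case: z. Qed.

Lemma creM z w : cre (z * w) = cre z * cre w - cim z * cim w.
Proof. by case: z w => [a b] [c d]. Qed.

Lemma cimM z w : cim (z * w) = cre z * cim w + cim z * cre w.
Proof. by case: z w => [a b] [c d]. Qed.

Lemma cre_conj z : cre (z^*)%R = cre z. Proof. by case: z. Qed.

Lemma cim_conj z : cim (z^*)%R = - cim z. Proof. by case: z. Qed.

Lemma cre_real r : cre (r%:C) = r. Proof. by []. Qed.

Lemma cim_real r : cim (r%:C) = 0. Proof. by []. Qed.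

Lemma cre_i : cre ('i%R : R[i]) = 0. Proof. by []. Qed.

Lemma cim_i : cim ('i%R : R[i]) = 1. Proof. by []. Qed.

Lemma cre0 : cre (0 : R[i]) = 0. Proof. by []. Qed.

Lemma cim0 : cim (0 : R[i]) = 0. Proof. by []. Qed.

Lemma cre1 : cre (1 : R[i]) = 1. Proof. by []. Qed.

Lemma cim1 : cim (1 : R[i]) = 0. Proof. by []. Qed.

Definition partsE := (creD, cimD, creN, cimN, creM, cimM, cre_conj, cim_conj,
  cre_real, cim_real, cre_i, cim_i, cre0, cim0, cre1, cim1).

Lemma conj_real r : ((r%:C)^*)%R = r%:C.
Proof. by apply: complex_ext; rewrite !partsE ?oppr0. Qed.

Lemma complex_ge0 z : (0 <= z) = (cim z == 0) && (0 <= cre z).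
Proof. by rewrite lecE. Qed.

Lemma cnorm2_ge0 z : 0 <= cnorm2 z.
Proof. by rewrite /cnorm2 addr_ge0 // sqr_ge0. Qed.

Lemma cnorm2M z w : cnorm2 (z * w) = cnorm2 z * cnorm2 w.
Proof. by rewrite /cnorm2 !partsE; ring. Qed.

Lemma cnorm2_real r : cnorm2 r%:C = r ^+ 2.
Proof. by rewrite /cnorm2 !partsE expr0n /= addr0. Qed.

Lemma cnorm2_0 : cnorm2 (0 : R[i]) = 0.
Proof. by rewrite /cnorm2 !partsE expr0n /= addr0. Qed.

Lemma cnorm2D_le z w : cnorm2 (z + w) <= 2 * cnorm2 z + 2 * cnorm2 w.
Proof.
rewrite /cnorm2 !partsE.
have := sqr_ge0 (cre z - cre w); have := sqr_ge0 (cim z - cim w); lra.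
Qed.

Lemma normr_cre_conjM z w : `|cre (z^* * w)| <= cnorm2 z + cnorm2 w.
Proof.
case: z w => [a b] [c d]; rewrite ler_norml /cnorm2 !partsE /cre /cim /=.
have := (sqr_ge0 (a - c), sqr_ge0 (a + c), sqr_ge0 (b - d), sqr_ge0 (b + d),
  sqr_ge0 a, sqr_ge0 b, sqr_ge0 c, sqr_ge0 d).
by move=> [[[[[[[? ?] ?] ?] ?] ?] ?] ?]; apply/andP; split; lra.
Qed.

Lemma normr_cim_conjM z w : `|cim (z^* * w)| <= cnorm2 z + cnorm2 w.
Proof.
case: z w => [a b] [c d]; rewrite ler_norml /cnorm2 !partsE /cre /cim /=.
have := (sqr_ge0 (a - d), sqr_ge0 (a + d), sqr_ge0 (b - c), sqr_ge0 (b + c),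
  sqr_ge0 a, sqr_ge0 b, sqr_ge0 c, sqr_ge0 d).
by move=> [[[[[[[? ?] ?] ?] ?] ?] ?] ?]; apply/andP; split; lra.
Qed.

End ComplexParts.

(** * Complex-valued integrals and almost everywhere equality *)

Section ComplexIntegral.
Variable R : realType.
Local Notation mu := (@lebesgue_measure R).
Implicit Types (f g h : R -> R[i]) (D : set R).

Definition cmeasurable D f :=
  measurable_fun D (@cre _ \o f) /\ measurable_fun D (@cim _ \o f).

Definition cintegrable D f :=
  mu.-integrable D (EFin \o (@cre _ \o f)) /\ mu.-integrable D (EFin \o (@cim _ \o f)).

Lemma cre_cint D f : cre (cint D f) = Rintegral mu D (@cre _ \o f).
Proof. by rewrite /cint !partsE; ring. Qed.

Lemma cim_cint D f : cim (cint D f) = Rintegral mu D (@cim _ \o f).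
Proof. by rewrite /cint !partsE; ring. Qed.

Lemma cmeasurableD D f g : cmeasurable D f -> cmeasurable D g ->
  cmeasurable D (fun x => f x + g x).
Proof.
move=> [f1 f2] [g1 g2]; split.
  rewrite (_ : _ \o _ = (@cre _ \o f) \+ (@cre _ \o g)); first exact: measurable_funD.
  by apply/funext => x /=; rewrite partsE.
rewrite (_ : _ \o _ = (@cim _ \o f) \+ (@cim _ \o g)); first exact: measurable_funD.
by apply/funext => x /=; rewrite partsE.
Qed.

Lemma cmeasurableM D f g : cmeasurable D f -> cmeasurable D g ->
  cmeasurable D (fun x => f x * g x).
Proof.
move=> [f1 f2] [g1 g2]; split.
  rewrite (_ : _ \o _ = ((@cre _ \o f) \* (@cre _ \o g)) \- ((@cim _ \o f) \* (@cim _ \o g))).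
    by apply: measurable_funB; apply: measurable_funM.
  by apply/funext => x /=; rewrite partsE.
rewrite (_ : _ \o _ = ((@cre _ \o f) \* (@cim _ \o g)) \+ ((@cim _ \o f) \* (@cre _ \o g))).
  by apply: measurable_funD; apply: measurable_funM.
by apply/funext => x /=; rewrite partsE.
Qed.

Lemma cmeasurable_cst D (a : R[i]) : cmeasurable D (fun=> a).
Proof. by split; exact: measurable_cst. Qed.

Lemma cmeasurable_conj D f : cmeasurable D f -> cmeasurable D (fun x => ((f x)^*)%R).
Proof.
move=> [f1 f2]; split.
  by rewrite (_ : _ \o _ = @cre _ \o f) //; apply/funext => x /=; rewrite partsE.
rewrite (_ : _ \o _ = \- (@cim _ \o f)); last first.
  by apply/funext => x /=; rewrite partsE.
exact: measurableT_comp.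
Qed.

Lemma measurable_cnorm2 D f : cmeasurable D f ->
  measurable_fun D (fun x => cnorm2 (f x)).
Proof.
by move=> [f1 f2]; apply: measurable_funD; apply: (measurable_funX 2).
Qed.

Lemma cint_lin D (a : R[i]) f g : measurable D ->
  cintegrable D f -> cintegrable D g ->
  cint D (fun x => a * f x + g x) = a * cint D f + cint D g.
Proof.
move=> mD [f1 f2] [g1 g2].
have Z (r : R) (u : R -> R) : mu.-integrable D (EFin \o u) ->
    mu.-integrable D (EFin \o (fun x => r * u x)).
  by move=> iu; exact: (integrableZl _ r iu).
have Dd (u v : R -> R) : mu.-integrable D (EFin \o u) ->
    mu.-integrable D (EFin \o v) ->
    mu.-integrable D (EFin \o (fun x => u x + v x)).
  by move=> iu iv; exact: (integrableD _ iu iv).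
apply: complex_ext.
  rewrite [RHS]creD [cre (a * _)]creM !cre_cint cim_cint.
  under eq_Rintegral => x _ do rewrite /= creD creM -mulNr.
  by rewrite !RintegralD ?RintegralZl //; do ?[exact: Dd | exact: Z | ring];
     apply: Dd; exact: Z.
rewrite [RHS]cimD [cim (a * _)]cimM cre_cint !cim_cint.
under eq_Rintegral => x _ do rewrite /= cimD cimM.
by rewrite !RintegralD ?RintegralZl //; do ?[exact: Dd | exact: Z | ring];
   apply: Dd; exact: Z.
Qed.

(** Together with [aeq_imp2], this allows rewriting with almost everywhere equalities: the goal is
    checked only at points where they hold. *)
Lemma aeq_imp (P : R -> Prop) f g : aeq f g -> (forall x, f x = g x -> P x) ->
  {ae mu, forall x, P x}.
Proof.
move=> fg fgP; apply: (negligibleS _ fg) => x /=.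
by apply: contra_not; exact: fgP.
Qed.

Lemma aeq_imp2 (P : R -> Prop) f1 g1 f2 g2 : aeq f1 g1 -> aeq f2 g2 ->
  (forall x, f1 x = g1 x -> f2 x = g2 x -> P x) -> {ae mu, forall x, P x}.
Proof.
move=> fg1 fg2 fgP; apply: (negligibleS _ (negligibleU fg1 fg2)) => x /= nP.
by apply: contrapT => /not_orP[/contrapT e1 /contrapT e2]; apply/nP/fgP.
Qed.

Lemma aeq_refl f : aeq f f.
Proof. by rewrite /aeq; apply/aeW. Qed.

Lemma cint_aeq D f g : measurable D -> cmeasurable D f -> cmeasurable D g ->
  aeq f g -> cint D f = cint D g.
Proof.
move=> mD [f1 f2] [g1 g2] fg; apply: complex_ext; rewrite ?cre_cint ?cim_cint;
  congr fine; apply: ae_eq_integral => //; try (by apply/measurable_EFinP).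
  by apply: (aeq_imp fg) => x /= -> _.
by apply: (aeq_imp fg) => x /= -> _.
Qed.

End ComplexIntegral.

(** * Square integrable functions and their inner product *)

Section SquareIntegrable.
Variable R : realType.
Local Notation mu := (@lebesgue_measure R).
Implicit Types (f g h : R -> R[i]) (a b : R[i]).

Lemma L2_cmeasurable f : L2 f -> cmeasurable setT f.
Proof. by move=> [? []]. Qed.

Lemma L2_integrable f : L2 f -> mu.-integrable setT (EFin \o (fun x => cnorm2 (f x))).
Proof.
move=> f2; have mf := measurable_cnorm2 (L2_cmeasurable f2).
apply/integrableP; split; first exact/measurable_EFinP.
under eq_integral do rewrite /= ger0_norm ?cnorm2_ge0 //.
by case: f2 => _ [].
Qed.

Lemma L2_dominated f (u : R -> R) : cmeasurable setT f ->
  mu.-integrable setT (EFin \o u) -> (forall x, cnorm2 (f x) <= u x) -> L2 f.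
Proof.
move=> [f1 f2] iu fu; split; [|split] => //.
have : mu.-integrable setT (EFin \o (fun x => cnorm2 (f x))).
  apply: (le_integrable _ _ _ iu) => //.
    by apply/measurable_EFinP; apply: measurable_cnorm2.
  move=> x _ /=; rewrite lee_fin !ger0_norm ?cnorm2_ge0 //.
  by rewrite (le_trans _ (fu x)) ?cnorm2_ge0.
move=> /integrableP[_]; apply: le_lt_trans.
by under [leRHS]eq_integral do rewrite /= ger0_norm ?cnorm2_ge0 //.
Qed.

Lemma L2_lin a f g : L2 f -> L2 g -> L2 (fun x => a * f x + g x).
Proof.
move=> f2 g2.
apply: (@L2_dominated _ (fun x => 2 * cnorm2 a * cnorm2 (f x) + 2 * cnorm2 (g x))).
- apply: cmeasurableD; last exact: L2_cmeasurable.
  apply: cmeasurableM; [exact: cmeasurable_cst|exact: L2_cmeasurable].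
- apply: (integrableD _ (integrableZl _ (2 * cnorm2 a) (L2_integrable f2))
    (integrableZl _ 2 (L2_integrable g2))) => //.
- by move=> x; rewrite -mulrA -cnorm2M cnorm2D_le.
Qed.

Lemma L2_cst0 : L2 (fun=> 0 : R[i]).
Proof.
split; [|split]; do ?exact: measurable_cst.
by under eq_integral do rewrite cnorm2_0; rewrite integral0.
Qed.

Lemma L2_scale a f : L2 f -> L2 (fun x => a * f x).
Proof.
move=> f2; have := L2_lin a f2 L2_cst0.
by congr L2; apply/funext => x; rewrite addr0.
Qed.

Lemma L2D f g : L2 f -> L2 g -> L2 (fun x => f x + g x).
Proof.
move=> f2 g2; have := L2_lin 1 f2 g2.
by congr L2; apply/funext => x; rewrite mul1r.
Qed.

Lemma L2_cmeasurable_inner f g : L2 f -> L2 g ->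
  cmeasurable setT (fun x => (f x)^* * g x).
Proof.
by move=> f2 g2; apply: cmeasurableM; [apply: cmeasurable_conj|];
  exact: L2_cmeasurable.
Qed.

(** The crude pointwise bound of both parts by [cnorm2 (f x) + cnorm2 (g x)] gives an integrable
    majorant, so Cauchy-Schwarz is avoided. *)
Lemma L2_cintegrable f g : L2 f -> L2 g ->
  cintegrable setT (fun x => (f x)^* * g x).
Proof.
move=> f2 g2; have [m1 m2] := L2_cmeasurable_inner f2 g2.
have I := integrableD measurableT (L2_integrable f2) (L2_integrable g2).
split; apply: (le_integrable _ _ _ I) => //; do ?exact/measurable_EFinP.
  move=> x _ /=; rewrite lee_fin [leRHS]ger0_norm;
    last by apply: addr_ge0; exact: cnorm2_ge0.
  exact: normr_cre_conjM.
move=> x _ /=; rewrite lee_fin [leRHS]ger0_norm;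
    last by apply: addr_ge0; exact: cnorm2_ge0.
exact: normr_cim_conjM.
Qed.

Lemma inner_linr a f g h : L2 f -> L2 g -> L2 h ->
  inner f (fun x => a * g x + h x) = a * inner f g + inner f h.
Proof.
move=> f2 g2 h2; rewrite /inner -cint_lin //; try exact: L2_cintegrable.
by congr cint; apply/funext => x; ring.
Qed.

Lemma inner_linl a f g h : L2 f -> L2 g -> L2 h ->
  inner (fun x => a * f x + g x) h = a^* * inner f h + inner g h.
Proof.
move=> f2 g2 h2; rewrite /inner -cint_lin //; try exact: L2_cintegrable.
by congr cint; apply/funext => x; rewrite rmorphD rmorphM; ring.
Qed.

Lemma inner0r f : L2 f -> inner f (fun=> 0) = 0.
Proof.
move=> f2; have := inner_linr 1 f2 L2_cst0 L2_cst0.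
rewrite (_ : (fun x => 1 * 0 + 0) = fun=> 0); last first.
  by apply/funext => x; rewrite mul1r addr0.
by rewrite mul1r -[LHS]addr0 => /addrI.
Qed.

Lemma inner_comb (r s : R) f g h : L2 f -> L2 g -> L2 h ->
  inner f (fun x => r%:C * g x + s%:C * h x) = r%:C * inner f g + s%:C * inner f h.
Proof.
move=> f2 g2 h2; rewrite inner_linr //; last exact: L2_scale.
congr (_ + _); have := inner_linr s%:C f2 h2 L2_cst0.
rewrite inner0r // addr0 => <-.
by congr inner; apply/funext => x; rewrite addr0.
Qed.

Lemma inner_aeqr f g h : L2 f -> L2 g -> L2 h -> aeq g h -> inner f g = inner f h.
Proof.
move=> f2 g2 h2 gh; apply: cint_aeq => //; do ?exact: L2_cmeasurable_inner.
by apply: (aeq_imp gh) => x ->.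
Qed.

Lemma inner_self f : inner f f = (Rintegral mu setT (fun x => cnorm2 (f x)))%:C.
Proof.
apply: complex_ext; rewrite ?cre_cint ?cim_cint partsE.
  by congr Rintegral; apply/funext => x /=; rewrite /cnorm2 !partsE; ring.
rewrite (_ : _ \o _ = fun=> 0); first by rewrite /Rintegral integral0.
by apply/funext => x /=; rewrite !partsE; ring.
Qed.

Lemma inner_self_ge0 f : 0 <= cre (inner f f).
Proof. by rewrite inner_self partsE Rintegral_ge0 // => x _; exact: cnorm2_ge0. Qed.

Lemma inner_self_eq0 f : L2 f -> inner f f = 0 -> aeq f (fun=> 0).
Proof.
move=> f2; rewrite inner_self => /(congr1 (@cre _)); rewrite !partsE => f0.
have : ae_eq mu setT (EFin \o (fun x => cnorm2 (f x))) (cst 0%E).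
  apply/ae_eq_integral_abs => //.
    apply/measurable_EFinP; apply: measurable_cnorm2; exact: L2_cmeasurable.
  under eq_integral do rewrite /= ger0_norm ?cnorm2_ge0 //.
  apply/eqP; rewrite -fine_eq0; first by apply/eqP.
  by apply: integrable_fin_num => //; exact: L2_integrable.
apply: negligibleS => x /=; apply: contra_not => /(_ I) [] /eqP.
rewrite /cnorm2 paddr_eq0 ?sqr_ge0 // !sqrf_eq0 => /andP[/eqP ? /eqP ?].
exact: complex_ext.
Qed.

Lemma L2_sum n (a : nat -> R[i]) (F : nat -> R -> R[i]) : (forall k, L2 (F k)) ->
  L2 (fun x => \sum_(k < n) a k * F k x).
Proof.
move=> F2; elim: n => [|n IH].
  rewrite (_ : (fun x => _) = fun=> 0); first exact: L2_cst0.
  by apply/funext => x; rewrite big_ord0.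
rewrite (_ : (fun x => _) = fun x => (\sum_(k < n) a k * F k x) + a n * F n x).
  by apply: L2D => //; exact: L2_scale.
by apply/funext => x; rewrite big_ord_recr.
Qed.

Lemma inner_sumr n (a : nat -> R[i]) (F : nat -> R -> R[i]) f :
  L2 f -> (forall k, L2 (F k)) ->
  inner f (fun x => \sum_(k < n) a k * F k x) = \sum_(k < n) a k * inner f (F k).
Proof.
move=> f2 F2; elim: n => [|n IH].
  rewrite big_ord0 (_ : (fun x => _) = fun=> 0); first exact: inner0r.
  by apply/funext => x; rewrite big_ord0.
rewrite (_ : (fun x => _) = fun x => a n * F n x + (\sum_(k < n) a k * F k x)).
  by rewrite (inner_linr _ f2 (F2 n) (L2_sum n a F2)) IH big_ord_recr /= addrC.
by apply/funext => x; rewrite big_ord_recr /= addrC.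
Qed.

End SquareIntegrable.

(** * Bounded operators and their quadratic forms *)

Section Operators.
Variable R : realType.
Local Notation mu := (@lebesgue_measure R).
Implicit Types (f g h : R -> R[i]) (A B : op R).

(** A positive operator has a real form, so for it the real part loses nothing; a value in [R] suits
    order arguments and matches the additivity clause of [observable]. *)
Definition op_form A f : R := cre (inner f (A f)).

Definition op_comb (r : R) A (s : R) B : op R :=
  fun f x => r%:C * A f x + s%:C * B f x.

Lemma bounded_linear_L2 A f : bounded_linear A -> L2 f -> L2 (A f).
Proof. by move=> [+ _]; exact. Qed.

Lemma bounded_linear_lin A (a : R[i]) f g : bounded_linear A -> L2 f -> L2 g ->
  aeq (A (fun x => a * f x + g x)) (fun x => a * A f x + A g x).
Proof. by move=> [_ [_ [+ _]]]; exact. Qed.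

Lemma inner_self_comb_le (r s : R) f g : L2 f -> L2 g ->
  cre (inner (fun x => r%:C * f x + s%:C * g x) (fun x => r%:C * f x + s%:C * g x)) <=
  2 * r ^+ 2 * cre (inner f f) + 2 * s ^+ 2 * cre (inner g g).
Proof.
move=> f2 g2; rewrite !inner_self !partsE.
rewrite -!RintegralZl //; do ?exact: L2_integrable.
have If := integrableZl measurableT (2 * r ^+ 2) (L2_integrable f2).
have Ig := integrableZl measurableT (2 * s ^+ 2) (L2_integrable g2).
rewrite -RintegralD //.
apply: le_Rintegral => //.
- by apply: L2_integrable; apply: L2_lin => //; apply: L2_scale.
- exact: (integrableD _ If Ig).
- move=> x _; apply: le_trans (cnorm2D_le _ _) _.
  by rewrite !cnorm2M !cnorm2_real !mulrA.
Qed.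

Lemma bounded_linear_comb r A s B : bounded_linear A -> bounded_linear B ->
  bounded_linear (op_comb r A s B).
Proof.
move=> [A1 [A2 [A3 [ca A4]]]] [B1 [B2 [B3 [cb B4]]]]; split; [|split; [|split]].
- by move=> f f2; apply: L2_lin; [exact: A1|apply: L2_scale; exact: B1].
- move=> f g f2 g2 fg; apply: (aeq_imp2 (A2 _ _ f2 g2 fg) (B2 _ _ f2 g2 fg)).
  by move=> x Ax Bx; rewrite /op_comb Ax Bx.
- move=> a f g f2 g2; apply: (aeq_imp2 (A3 a _ _ f2 g2) (B3 a _ _ f2 g2)).
  by move=> x Ax Bx; rewrite /op_comb Ax Bx; ring.
- exists (2 * r ^+ 2 * ca + 2 * s ^+ 2 * cb) => f f2.
  apply: le_trans (inner_self_comb_le r s (A1 _ f2) (B1 _ f2)) _.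
  have r2 : 0 <= 2 * r ^+ 2 by rewrite mulr_ge0 ?sqr_ge0.
  have s2 : 0 <= 2 * s ^+ 2 by rewrite mulr_ge0 ?sqr_ge0.
  have := ler_wpM2l r2 (A4 _ f2); have := ler_wpM2l s2 (B4 _ f2); lra.
Qed.

Lemma inner_op_comb r A s B f : bounded_linear A -> bounded_linear B -> L2 f ->
  inner f (op_comb r A s B f) = r%:C * inner f (A f) + s%:C * inner f (B f).
Proof.
by move=> bA bB f2; rewrite inner_comb //; exact: bounded_linear_L2.
Qed.

Lemma op_form_comb r A s B f : bounded_linear A -> bounded_linear B -> L2 f ->
  op_form (op_comb r A s B) f = r * op_form A f + s * op_form B f.
Proof.
move=> bA bB f2; rewrite /op_form inner_op_comb // creD !creM !cre_real !cim_real.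
by rewrite !mul0r !subr0.
Qed.

Lemma positive_op_comb r A s B : 0 <= r -> 0 <= s ->
  bounded_linear A -> bounded_linear B -> positive_op A -> positive_op B ->
  positive_op (op_comb r A s B).
Proof.
move=> r0 s0 bA bB pA pB f f2; rewrite inner_op_comb //.
by rewrite addr_ge0 // mulr_ge0 ?lecR //; [exact: pA|exact: pB].
Qed.

Lemma bounded_linear_id : bounded_linear (id : op R).
Proof.
split=> //; split=> //; split; first by move=> *; exact: aeq_refl.
by exists 1 => f f2; rewrite mul1r.
Qed.

Lemma positive_op_id : positive_op (id : op R).
Proof.
move=> f _; rewrite complex_ge0 inner_self_ge0 andbT inner_self.
by rewrite cim_real.
Qed.

Lemma op_form_ge0 A f : positive_op A -> L2 f -> 0 <= op_form A f.
Proof. by move=> pA /pA; rewrite complex_ge0 => /andP[]. Qed.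

(* Polarization: over the complex field the quadratic form determines the operator. *)
Lemma op_form_eq0 A : bounded_linear A -> positive_op A ->
  (forall f, L2 f -> op_form A f = 0) -> forall f, L2 f -> aeq (A f) (fun=> 0).
Proof.
move=> bA pA A0.
have Z f : L2 f -> inner f (A f) = 0.
  move=> f2; apply: complex_ext; first by rewrite [LHS]A0.
  by have := pA _ f2; rewrite complex_ge0 => /andP[/eqP].
have AL2 f : L2 f -> L2 (A f) by exact: bounded_linear_L2.
(* The diagonal terms of the form at [a * f + g] vanish by [Z]; only the cross terms remain. *)
have P (a : R[i]) f g : L2 f -> L2 g ->
    a^* * inner f (A g) + a * inner g (A f) = 0.
  move=> f2 g2; have h2 := L2_lin a f2 g2.
  have Ah2 := L2_lin a (AL2 _ f2) (AL2 _ g2).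
  have := Z _ h2; rewrite (inner_aeqr h2 (AL2 _ h2) Ah2); last first.
    exact: bounded_linear_lin.
  rewrite (inner_linl a f2 g2 Ah2) (inner_linr a f2 (AL2 _ f2) (AL2 _ g2)).
  rewrite (inner_linr a g2 (AL2 _ f2) (AL2 _ g2)) !Z //.
  by rewrite mulr0 add0r addr0.
move=> f f2; apply: inner_self_eq0; first exact: AL2.
(* With [u] the inner square of [A f] and [v] the other cross term, [a = 1] gives [u + v = 0] and
   [a = i] gives [v = u]; hence [u = 0]. *)
have := P 1 _ _ (AL2 _ f2) f2; have := P 'i%R _ _ (AL2 _ f2) f2.
set u := inner _ _; set v := inner _ _; rewrite rmorph1 !mul1r.
rewrite conjCi mulNr addrC -mulrBr => /eqP; rewrite mulf_eq0 => /orP[/eqP/(congr1 (@cim _))|].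
  by rewrite !partsE => /eqP; rewrite oner_eq0.
rewrite subr_eq0 => /eqP ->; rewrite -mulr2n => /eqP.
by rewrite mulrn_eq0 /= => /eqP.
Qed.

(* Parallelogram law with the term [op_form A (f - g)] dropped. *)
Lemma op_formD_le A f g : bounded_linear A -> positive_op A -> L2 f -> L2 g ->
  op_form A (fun x => f x + g x) <= 2 * op_form A f + 2 * op_form A g.
Proof.
move=> bA pA f2 g2.
have AL2 h : L2 h -> L2 (A h) by exact: bounded_linear_L2.
(* A real parameter covers [r = 1] and [r = -1] at once; adding the two cases cancels the cross
   terms. *)
have E (r : R) : op_form A (fun x => r%:C * f x + g x) =
    r ^+ 2 * op_form A f + r * cre (inner f (A g) + inner g (A f)) + op_form A g.
  have h2 := L2_lin r%:C f2 g2.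
  have Ah2 := L2_lin r%:C (AL2 _ f2) (AL2 _ g2).
  rewrite /op_form (inner_aeqr h2 (AL2 _ h2) Ah2); last exact: bounded_linear_lin.
  rewrite (inner_linl r%:C f2 g2 Ah2) (inner_linr r%:C f2 (AL2 _ f2) (AL2 _ g2)).
  rewrite (inner_linr r%:C g2 (AL2 _ f2) (AL2 _ g2)) conj_real.
  set u := inner _ _; set v := inner _ _; set w := inner _ _; set z := inner _ _.
  by rewrite !partsE; ring.
have := op_form_ge0 pA (L2_lin (-1)%:C f2 g2); rewrite (E (-1)).
rewrite (_ : (fun x => f x + g x) = fun x => 1%:C * f x + g x); last first.
  by apply/funext => x; rewrite mul1r.
by rewrite E; lra.
Qed.

Lemma op_form_scale A (r : R) f : bounded_linear A -> L2 f ->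
  op_form A (fun x => r%:C * f x) = r ^+ 2 * op_form A f.
Proof.
move=> bA f2; rewrite /op_form.
have AL2 h : L2 h -> L2 (A h) by exact: bounded_linear_L2.
have z2 : L2 (fun=> 0 : R[i]) by exact: L2_cst0.
have rf2 := L2_scale r%:C f2.
(* Linearity with [a = -1] at the zero vector reads [A 0 = - A 0 + A 0]. *)
have Az : aeq (A (fun=> 0)) (fun=> 0).
  have := bounded_linear_lin (-1) bA z2 z2.
  rewrite (_ : (fun x => -1 * 0 + 0) = (fun=> 0)); last first.
    by apply/funext => x; rewrite mulr0 addr0.
  by move=> h; apply: (aeq_imp h) => x ->; rewrite mulN1r addNr.
have AE : aeq (A (fun x => r%:C * f x)) (fun x => r%:C * A f x + 0).
  have := bounded_linear_lin r%:C bA f2 z2.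
  rewrite (_ : (fun x => r%:C * f x + 0) = (fun x => r%:C * f x)); last first.
    by apply/funext => x; rewrite addr0.
  by move=> h; apply: (aeq_imp2 h Az) => x -> ->.
rewrite (inner_aeqr rf2 (AL2 _ rf2) _ AE); last exact: L2_lin (AL2 _ f2) z2.
rewrite (inner_linr r%:C rf2 (AL2 _ f2) z2) inner0r // addr0.
have := inner_linl r%:C f2 z2 (AL2 _ f2).
rewrite (_ : (fun x => r%:C * f x + 0) = (fun x => r%:C * f x)); last first.
  by apply/funext => x; rewrite addr0.
move=> ->; rewrite conj_real.
have -> : inner (fun=> 0 : R[i]) (A f) = 0.
  have := inner_linl 1 z2 z2 (AL2 _ f2).
  rewrite (_ : (fun x => 1 * 0 + 0) = fun=> 0); last first.
    by apply/funext => x; rewrite mul1r addr0.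
  by rewrite rmorph1 mul1r -[LHS]addr0 => /addrI.
by rewrite addr0; set u := inner _ _; rewrite !partsE; ring.
Qed.

(** Iterates the parallelogram bound, each new term costing a factor 2. The crude [2 ^+ n] is
    harmless because [n] will be fixed before the small parameter is chosen. *)
Lemma op_form_sum_le A (n : nat) (a : nat -> R) (F : nat -> R -> R[i]) :
  bounded_linear A -> positive_op A -> (forall k, L2 (F k)) ->
  op_form A (fun x => \sum_(k < n) (a k)%:C * F k x) <=
    2 ^+ n * \sum_(k < n) a k ^+ 2 * op_form A (F k).
Proof.
move=> bA pA F2; elim: n => [|n IH].
  rewrite (_ : (fun x => _) = fun x => 0%:C * 0); last first.
    by apply/funext => x; rewrite big_ord0 mulr0.
  by rewrite (op_form_scale 0 bA (L2_cst0 R)) expr0n /= mul0r big_ord0 mulr0.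
rewrite (_ : (fun x => _) = fun x => (\sum_(k < n) (a k)%:C * F k x) +
  (a n)%:C * F n x); last by apply/funext => x; rewrite big_ord_recr.
have L := L2_sum n (fun k => (a k)%:C) F2; have L' := L2_scale (a n)%:C (F2 n).
apply: le_trans (op_formD_le bA pA L L') _.
rewrite op_form_scale // big_ord_recr /= [2 ^+ n.+1]exprS.
have t0 : 0 <= a n ^+ 2 * op_form A (F n) by rewrite mulr_ge0 ?sqr_ge0 ?op_form_ge0.
have := ler_peMl t0 (exprn_ege1 n (ler1n R 2)); move: IH t0.
move: (op_form A _) (2 ^+ n) (\sum_(k < n) _) (_ * op_form _ _) => u p S t.
by rewrite mulrDr -!mulrA; move: (p * S) (p * t) => ? ?; lra.
Qed.

End Operators.

(** * Additivity and monotonicity of observables *)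

Section ObservableTheory.
Variables (R : realType) (d : measure_display) (T : measurableType d).
Implicit Types (M : set T -> op R) (f : R -> R[i]).

Lemma observable_bounded M Z : observable M -> measurable Z -> bounded_linear (M Z).
Proof. by move=> [+ _] => /[apply] -[]. Qed.

Lemma observable_positive M Z : observable M -> measurable Z -> positive_op (M Z).
Proof. by move=> [+ _] => /[apply] -[]. Qed.

(** For the constant sequence of empty sets the partial sums are [c *+ n]. They converge, so their
    increments tend to 0; but every increment equals [c]. *)
Lemma observable_form0 M f : observable M -> L2 f -> op_form (M set0) f = 0.
Proof.
move=> [_ [_ sM]] f2.
have t0 : trivIset setT (fun _ : nat => set0 : set T).
  by apply/trivIsetP => i j _ _ _; rewrite setI0.
have := sM (fun=> set0) (fun=> measurable0) t0 f f2.
rewrite bigcup0 // -/(op_form (M set0) f); set c := op_form _ _.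
rewrite (_ : (fun n => _) = fun n => c *+ n); last first.
  by apply/funext => n; rewrite sumr_const card_ord.
move=> h; have := h; rewrite -cvg_shiftS => /cvgB /(_ h).
rewrite subrr => h0.
have hc : (fun n => c *+ n.+1 - c *+ n) @ \oo --> c.
  rewrite (_ : (fun n => _) = cst c); first exact: cvg_cst.
  by apply/funext => n; rewrite mulrS addrK.
exact: (cvg_unique _ hc h0).
Qed.

Lemma observable_formU M Z1 Z2 f : observable M -> measurable Z1 -> measurable Z2 ->
  Z1 `&` Z2 = set0 -> L2 f ->
  op_form (M (Z1 `|` Z2)) f = op_form (M Z1) f + op_form (M Z2) f.
Proof.
move=> oM m1 m2 Z12 f2; have [_ [_ sM]] := oM.
have mZ k : measurable (bigcup2 Z1 Z2 k) by case: k => [|[|k]] //=; exact: measurable0.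
have := sM (bigcup2 Z1 Z2) mZ _ f f2.
rewrite -trivIset_bigcup2 => /(_ Z12).
(* All sets after the first two are empty, so the sequence of partial sums shifted by 2 is
   constant. *)
rewrite bigcup2E -/(op_form _ f) -(cvg_shiftn 2) => h.
set c := RHS.
have hc : (fun n => \sum_(k < n + 2) op_form (M (bigcup2 Z1 Z2 k)) f) @ \oo --> c.
  rewrite (_ : (fun n => _) = cst c); first exact: cvg_cst.
  apply/funext => n; rewrite addn2 !big_ord_recl /= big1 ?addr0 // => i _.
  exact: observable_form0.
exact: (cvg_unique _ h hc).
Qed.

Lemma observable_form_le M Z1 Z2 f : observable M -> measurable Z1 -> measurable Z2 ->
  Z1 `<=` Z2 -> L2 f -> op_form (M Z1) f <= op_form (M Z2) f.
Proof.
move=> oM m1 m2 Z12 f2; have m21 := measurableD m2 m1.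
rewrite -(setDUK Z12) observable_formU // ?lerDl; last by rewrite setDE setICA setICr setI0.
by apply: op_form_ge0 => //; exact: observable_positive.
Qed.

Lemma observable_formT M f : observable M -> L2 f -> op_form (M setT) f = cre (inner f f).
Proof.
move=> oM f2; congr cre; apply: inner_aeqr => //.
  exact: (bounded_linear_L2 (observable_bounded oM measurableT)).
by case: oM => _ [+ _]; exact.
Qed.

(** Additivity only yields a vanishing form; polarization upgrades this to a vanishing operator, as
    needed for the marginals of the axis observable. *)
Lemma observable0 M f : observable M -> L2 f -> aeq (M set0 f) (fun=> 0).
Proof.
move=> oM; apply: op_form_eq0; [exact: observable_bounded|exact: observable_positive|].
by move=> g g2; exact: observable_form0.
Qed.

(** Trivial noise is a multiple of the identity, so the mixture is an [op_comb] with [id]. *)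
Lemma op_form_mix M (lam : R) (nu : probability T R) X f : observable M ->
  measurable X -> L2 f ->
  op_form (mix lam M (triv_obs nu) X) f =
  lam * op_form (M X) f + (1 - lam) * fine (nu X) * cre (inner f f).
Proof.
move=> oM mX f2; rewrite (_ : mix _ _ _ _ = op_comb lam (M X)
    ((1 - lam) * fine (nu X)) id); last first.
  apply/funext => g; apply/funext => x; rewrite /mix /triv_obs /op_comb.
  by rewrite [in RHS]rmorphM mulrA.
rewrite op_form_comb //; [exact: observable_bounded|exact: bounded_linear_id].
Qed.

End ObservableTheory.

(** * Sufficiency: a joint observable carried by the two axes *)

Section AxisObservable.
Variable R : realType.
Implicit Types (Q P : set R -> op R) (f : R -> R[i]) (lam mu : R).

(* The marginals of [axis_observable] are the mixtures of [Q] and [P] with the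
   Dirac measure at 0: it places [Q] on the first axis and [P] on the second. *)
Definition axis_observable lam mu Q P : set (R * R) -> op R := fun Z =>
  op_comb 1 (op_comb lam (Q (ysection Z 0)) mu (P (xsection Z 0)))
    ((1 - lam - mu) * fine (\d_((0, 0) : R * R) Z)) id.

Lemma probability_fine_sigma_additive d (T : measurableType d)
    (nu : probability T R) (Z : nat -> set T) :
  (forall k, measurable (Z k)) -> trivIset setT Z ->
  (fun n => \sum_(k < n) fine (nu (Z k))) @ \oo --> fine (nu (\bigcup_k Z k)).
Proof.
move=> mZ tZ; have mU : measurable (\bigcup_k Z k) by exact: bigcup_measurable.
have := @measure_semi_sigma_additive _ _ _ nu Z mZ tZ mU.
rewrite -[X in _ --> X]fineK ?fin_num_measure // => /fine_cvg.
rewrite (_ : _ \o _ = (fun n => \sum_(k < n) fine (nu (Z k)))) //.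
apply/funext => n /=; rewrite big_mkord sum_fine // => k _.
exact: fin_num_measure.
Qed.

Lemma axis_observable_form lam mu Q P Z f : observable Q -> observable P ->
  measurable Z -> L2 f -> op_form (axis_observable lam mu Q P Z) f =
  lam * op_form (Q (ysection Z 0)) f + mu * op_form (P (xsection Z 0)) f +
  (1 - lam - mu) * fine (\d_((0, 0) : R * R) Z) * cre (inner f f).
Proof.
move=> oQ oP mZ f2.
have bQ := observable_bounded oQ (measurable_ysection (0 : R) mZ).
have bP := observable_bounded oP (measurable_xsection (0 : R) mZ).
rewrite /axis_observable op_form_comb ?op_form_comb // ?mul1r //.
- exact: bounded_linear_comb.
- exact: bounded_linear_id.
Qed.

(** Sections commute with countable unions and preserve disjointness, so additivity is inherited
    from [Q], [P] and the Dirac measure; [lam + mu <= 1] keeps the weight at the origin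
    nonnegative. *)
Lemma observable_axis lam mu Q P : 0 <= lam -> 0 <= mu -> lam + mu <= 1 ->
  observable Q -> observable P -> observable (axis_observable lam mu Q P).
Proof.
move=> lam0 mu0 lm1 oQ oP; split; [|split].
- move=> Z mZ.
  have mZy := measurable_ysection (0 : R) mZ; have mZx := measurable_xsection (0 : R) mZ.
  have bQ := observable_bounded oQ mZy; have bP := observable_bounded oP mZx.
  have bQP := bounded_linear_comb lam mu bQ bP.
  split; first by apply: bounded_linear_comb => //; exact: bounded_linear_id.
  apply: positive_op_comb => //.
  + by rewrite mulr_ge0 ?fine_ge0 //; lra.
  + exact: bounded_linear_id.
  + apply: positive_op_comb => //; exact: observable_positive.
  + exact: positive_op_id.
- move=> f f2; have [_ [/(_ _ f2) hQ _]] := oQ; have [_ [/(_ _ f2) hP _]] := oP.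
  rewrite /axis_observable diracT /=.
  have -> : ysection [set: R * R] 0 = [set: R].
    by apply/seteqP; split => // x _; apply/ysectionP.
  have -> : xsection [set: R * R] 0 = [set: R].
    by apply/seteqP; split => // x _; apply/xsectionP.
  apply: (aeq_imp2 hQ hP) => x Qx Px; rewrite /op_comb Qx Px mulr1.
  by rewrite /= !rmorphB rmorph1; ring.
- move=> Z mZ tZ f f2.
  have mU : measurable (\bigcup_k Z k) by exact: bigcup_measurable.
  rewrite [X in _ --> X](axis_observable_form _ _ oQ oP mU f2).
  rewrite (_ : (fun n => _) = fun n =>
      lam * (\sum_(k < n) op_form (Q (ysection (Z k) 0)) f) +
      mu * (\sum_(k < n) op_form (P (xsection (Z k) 0)) f) +
      (1 - lam - mu) * (\sum_(k < n) fine (\d_((0, 0) : R * R) (Z k))) *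
      cre (inner f f)); last first.
    apply/funext => n; rewrite !mulr_sumr mulr_suml -!big_split /=.
    by apply: eq_bigr => k _; exact: axis_observable_form.
  rewrite ysection_bigcup xsection_bigcup.
  have [_ [_ sQ]] := oQ; have [_ [_ sP]] := oP.
  apply: cvgD; [apply: cvgD|].
  + apply: cvgMr; apply: sQ => //; first by move=> k; exact: measurable_ysection.
    exact: trivIset_ysection.
  + apply: cvgMr; apply: sP => //; first by move=> k; exact: measurable_xsection.
    exact: trivIset_xsection.
  + apply: cvgMl; apply: cvgMr.
    exact: (probability_fine_sigma_additive (nu := \d_((0, 0) : R * R))).
Qed.

(** The section of [X * R] at 0 is the whole line or empty, according to whether 0 lies in [X]. In
    the first case [P] contributes [mu] and the origin [1 - lam - mu], which add up to the noise
    weight [1 - lam]; in the second both contribute 0. *)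
Lemma axis_observable_fst lam mu Q P X f : observable P ->
  measurable X -> L2 f ->
  aeq (axis_observable lam mu Q P (X `*` setT) f)
      (mix lam Q (triv_obs (\d_(0 : R) : probability R R)) X f).
Proof.
move=> oP mX f2; have [_ [/(_ _ f2) PT _]] := oP.
rewrite /axis_observable /mix /triv_obs !diracE in_ysectionX ?in_setT //.
rewrite in_setX in_setT andbT /=.
rewrite indicE; have [X0|X0] := boolP (0 \in X).
  rewrite in_xsectionX //; apply: (aeq_imp PT) => x Px.
  by rewrite /op_comb Px !mulr1 /= !rmorphB rmorph1 /=; ring.
rewrite notin_xsectionX //; apply: (aeq_imp (observable0 oP f2)) => x Px.
by rewrite /op_comb Px !mulr0 /= rmorph0 rmorph1 /=; ring.
Qed.

Lemma axis_observable_snd lam mu Q P Y f : observable Q ->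
  measurable Y -> L2 f ->
  aeq (axis_observable lam mu Q P (setT `*` Y) f)
      (mix mu P (triv_obs (\d_(0 : R) : probability R R)) Y f).
Proof.
move=> oQ mY f2; have [_ [/(_ _ f2) QT _]] := oQ.
rewrite /axis_observable /mix /triv_obs !diracE in_xsectionX ?in_setT //.
rewrite in_setX in_setT /=.
rewrite indicE; have [Y0|Y0] := boolP (0 \in Y).
  rewrite in_ysectionX //; apply: (aeq_imp QT) => x Qx.
  by rewrite /op_comb Qx !mulr1 /= !rmorphB rmorph1 /=; ring.
rewrite notin_ysectionX //; apply: (aeq_imp (observable0 oQ f2)) => x Qx.
by rewrite /op_comb Qx !mulr0 /= rmorph0 rmorph1 /=; ring.
Qed.

Lemma jm_region_triangle lam mu Q P : observable Q -> observable P ->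
  0 <= lam -> 0 <= mu -> lam + mu <= 1 -> jm_region Q P (lam, mu).
Proof.
move=> oQ oP lam0 mu0 lm1; split; [|split] => /=; [lra|lra|].
exists \d_(0 : R), \d_(0 : R), (axis_observable lam mu Q P).
split; first exact: observable_axis.
by split=> [X mX f f2|Y mY f f2]; [apply: axis_observable_fst|apply: axis_observable_snd].
Qed.

End AxisObservable.

(** * The Fourier integral of a unit box *)

Section ExponentialKernel.
Variable R : realType.
Local Notation mu := (@lebesgue_measure R).
Implicit Types (s t x y p c e : R).

Lemma cre_expi t : cre (expi t) = cos t.
Proof. by rewrite /expi !partsE; ring. Qed.

Lemma cim_expi t : cim (expi t) = sin t.
Proof. by rewrite /expi !partsE; ring. Qed.

Lemma expiD s t : expi (s + t) = expi s * expi t.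
Proof.
by apply: complex_ext; rewrite ?creM ?cimM !cre_expi !cim_expi ?cosD ?sinD; ring.
Qed.

Lemma expi0 : expi (0 : R) = 1.
Proof. by apply: complex_ext; rewrite ?cre_expi ?cim_expi ?cos0 ?sin0. Qed.

Lemma expi_conj t : ((expi t)^*)%R = expi (- t).
Proof.
apply: complex_ext; first by rewrite cre_conj !cre_expi cosN.
by rewrite cim_conj !cim_expi sinN.
Qed.

Lemma cnorm2_expi t : cnorm2 (expi t) = 1.
Proof. by rewrite /cnorm2 cre_expi cim_expi cos2Dsin2. Qed.

Lemma expi_natmul (n : nat) t : expi (n%:R * t) = expi t ^+ n.
Proof.
elim: n => [|n IH]; first by rewrite mul0r expi0 expr0.
by rewrite -natr1 mulrDl mul1r expiD IH exprSr.
Qed.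

Lemma sqr_sin_le t : sin t ^+ 2 <= t ^+ 2.
Proof.
wlog t0 : t / 0 < t => [H|].
  have [/H //|t0|<-] := ltgtP 0 t; last by rewrite sin0.
  by rewrite -sqrrN -[leRHS]sqrrN -sinN; apply: H; rewrite oppr_gt0.
have [|u _] := @MVT R (@sin R) (@cos R) 0 t t0 (fun x _ => is_derive_sin x).
  exact/continuous_subspaceT/continuous_sin.
by rewrite sin0 !subr0 => ->; rewrite exprMn ler_piMl ?sqr_ge0 //.
Qed.

Lemma cnorm2_1Bexpi t : cnorm2 (1 - expi t) = (1 - cos t) ^+ 2 + sin t ^+ 2.
Proof.
by rewrite /cnorm2 creD creN cre_expi cimD cimN cim_expi /= add0r sqrrN.
Qed.

(** A chord is no longer than its arc: by the half-angle formulas the left side is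
    [4 * sin (t / 2) ^+ 2]. *)
Lemma cnorm2_expi_sub1 t : cnorm2 (1 - expi t) <= t ^+ 2.
Proof.
have := sqr_sin_le (t / 2); rewrite cnorm2_1Bexpi.
have := cos2Dsin2 t; have : cos t = cos (t / 2) ^+ 2 - sin (t / 2) ^+ 2.
  by rewrite [in LHS](_ : t = t / 2 + t / 2) ?cosD; [ring|field].
rewrite expr_div_n; have := cos2Dsin2 (t / 2).
move: (cos t) (sin t) (cos (t / 2) ^+ 2) (sin (t / 2) ^+ 2) (t ^+ 2) => C S c s T.
by move=> ? -> ? ?; nra.
Qed.

(* The integral of [x |-> expi (- (x * s))] over [c, c + 1]; division by 0
   gives 0, whence the correction at [s = 0]. *)
Definition box_kernel c s : R[i] :=
  (((sin ((c + 1) * s) - sin (c * s)) / s + (s == 0)%:R) +i*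
   ((cos ((c + 1) * s) - cos (c * s)) / s))%C.

(** Translation in position is multiplication by a phase in momentum. This is what will turn a
    combination of translates into a polynomial in one phase. *)
Lemma box_kernel_shift c e s :
  box_kernel (c + e) s = expi (- (e * s)) * box_kernel c s.
Proof.
rewrite /box_kernel.
have [->|s0] := eqVneq s 0.
  by rewrite !mulr0 !oppr0 expi0 mul1r !sin0 !cos0 !subrr.
apply: complex_ext; rewrite ?creM ?cimM cre_expi cim_expi /cre /cim /= cosN sinN.
  rewrite (_ : (c + e + 1) * s = (c + 1) * s + e * s); last by ring.
  by rewrite [(c + e) * s]mulrDl !(sinD _ (e * s)) !addr0; field.
rewrite (_ : (c + e + 1) * s = (c + 1) * s + e * s); last by ring.
by rewrite [(c + e) * s]mulrDl !(cosD _ (e * s)) !addr0; field.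
Qed.

(** The shift reduces to [c = 0]. For nonzero [s] the squared modulus is [N / s ^+ 2] with
    [N = cnorm2 (1 - expi s)]; since [N] is at most [s ^+ 2] and at most 4, [N * (1 + s ^+ 2)] is at
    most [5 * s ^+ 2]. *)
Lemma cnorm2_box_kernel c s : cnorm2 (box_kernel c s) <= 5 * (oneDsqr s)^-1.
Proof.
rewrite -[c]add0r box_kernel_shift cnorm2M cnorm2_expi mul1r.
have s1 : 0 < oneDsqr s by exact: (lt_le_trans ltr01 (oneDsqr_ge1 s)).
rewrite ler_pdivlMr // /oneDsqr /box_kernel /cnorm2 /cre /cim /=.
rewrite !mul0r sin0 cos0 add0r mul1r subr0.
have [->|s0] := eqVneq s 0.
  rewrite sin0 cos0 invr0 !mulr0 add0r /=; lra.
rewrite addr0 !expr_div_n -mulrDl.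
have s2 : 0 < s ^+ 2 by rewrite exprn_even_gt0.
rewrite mulrAC ler_pdivrMr //.
have := cnorm2_expi_sub1 s; rewrite cnorm2_1Bexpi.
have := cos2Dsin2 s; have := sqr_ge0 (sin s); have := cos_le1 s; have := cos_geN1 s.
by move: (s ^+ 2) s2 => S; set C := cos s; set D := sin s => *; nra.
Qed.

Lemma Rintegral_FTC (f F : R -> R) (a b : R) : a < b -> continuous f ->
  (forall x, is_derive x 1 F (f x)) -> \int[mu]_(x in `[a, b]) f x = F b - F a.
Proof.
move=> ab cf dF; rewrite /Rintegral (@continuous_FTC2 _ f F) //.
- exact/continuous_subspaceT.
- have cF : continuous F.
    by move=> x; apply/differentiable_continuous/derivable1_diffP; exact: ex_derive.
  split; [by move=> x _; exact: ex_derive| |].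
  + exact/cvg_at_right_filter/cF.
  + exact/cvg_at_left_filter/cF.
- by move=> x _; rewrite derive1E; exact: derive_val.
Qed.

Lemma cint_box_kernel c s :
  cint `[c, c + 1] (fun x => expi (- (x * s))) = box_kernel c s.
Proof.
have c1 : c < c + 1 by rewrite ltrDl.
have cxs : continuous (fun x : R => x * s) by move=> x; exact: mulrr_continuous.
apply: complex_ext.
  rewrite cre_cint (_ : _ \o _ = fun x => cos (x * s)); last first.
    by apply/funext => x; rewrite [LHS]cre_expi cosN.
  have [->|s0] := eqVneq s 0.
    rewrite /box_kernel /cre /= eqxx invr0 mulr0 add0r.
    rewrite (_ : (fun x => _) = fun=> 1); last by apply/funext => x; rewrite mulr0 cos0.
    rewrite Rintegral_cst //= lebesgue_measure_itv /= lte_fin c1 /=.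
    by rewrite mul1r addrAC subrr add0r.
  have dF x : is_derive x 1 (fun x => sin (x * s) / s) (cos (x * s)).
    by apply: is_derive_eq; rewrite /GRing.scale /=; field.
  rewrite (Rintegral_FTC c1 _ dF).
    by rewrite /box_kernel /cre /= (negbTE s0) addr0 mulrBl.
  by move=> x; apply: continuous_comp; [exact: cxs|exact: continuous_cos].
rewrite cim_cint (_ : _ \o _ = fun x => - sin (x * s)); last first.
  by apply/funext => x; rewrite [LHS]cim_expi sinN.
have [->|s0] := eqVneq s 0.
  rewrite /box_kernel /cim /= invr0 mulr0.
  rewrite (_ : (fun x => _) = fun=> 0); last first.
    by apply/funext => x; rewrite mulr0 sin0 oppr0.
  by rewrite Rintegral_cst ?mul0r.
have dF x : is_derive x 1 (fun x => cos (x * s) / s) (- sin (x * s)).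
  by apply: is_derive_eq; rewrite /GRing.scale /=; field.
rewrite (Rintegral_FTC c1 _ dF); first by rewrite /box_kernel /cim /= mulrBl.
move=> x; apply: cvgN; apply: continuous_comp; [exact: cxs|exact: continuous_sin].
Qed.

Lemma measurable_invr : measurable_fun setT (fun x : R => x^-1).
Proof.
(* Expresses the inverse through the measurable [powR]; the factor [x] restores the sign and gives
   the value 0 at 0. *)
rewrite (_ : (fun x => _) = (fun x : R => x * (`|x| `^ (-1)) ^+ 2)); last first.
  apply/funext => x; rewrite powR_inv1 // exprVn real_normK ?num_real //.
  by have [->|x0] := eqVneq x 0; [rewrite invr0 mul0r|field].
apply: measurable_funM => //; apply: measurable_funX.
by apply: (@measurableT_comp _ _ _ _ _ _ (@powR R ^~ (-1)) _ (fun x : R => `|x|)) => //; exact: measurable_powR.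
Qed.

Lemma cmeasurable_box_kernel c p :
  cmeasurable setT (fun y => box_kernel c (y - p)).
Proof.
have mS : measurable_fun setT (fun y : R => y - p).
  by apply: measurable_funB => //; exact: measurable_cst.
have mV : measurable_fun setT (fun y : R => (y - p)^-1).
  exact: (measurableT_comp measurable_invr mS).
have mL a : measurable_fun setT (fun y : R => a * (y - p)).
  by apply: measurable_funM => //; exact: measurable_cst.
have msin a : measurable_fun setT (fun y : R => sin (a * (y - p))).
  by apply: (measurableT_comp _ (mL a)); exact: continuous_measurable_fun (@continuous_sin R).
have mcos a : measurable_fun setT (fun y : R => cos (a * (y - p))).
  by apply: (measurableT_comp _ (mL a)); exact: continuous_measurable_fun (@continuous_cos R).
split.
  apply: measurable_funD.
    by apply: measurable_funM => //; apply: measurable_funB.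
  rewrite (_ : (fun y => _) = \1_[set p]); first exact: measurable_indic.
  by apply/funext => y; rewrite indicE in_set1 subr_eq0.
by apply: measurable_funM => //; apply: measurable_funB.
Qed.

End ExponentialKernel.

(** * Translation invariance of Lebesgue measure *)

Section Translation.
Variable R : realType.
Local Notation mu := (@lebesgue_measure R).

Let shift (p : R) : measurableTypeR R -> measurableTypeR R := fun y => y - p.

Let measurable_shift (p : R) : measurable_fun setT (shift p).
Proof. by apply: measurable_funB => //; exact: measurable_cst. Qed.

(** The pushforward under translation agrees with Lebesgue measure on half-open intervals, and these
    determine it. *)
Lemma lebesgue_measure_shift (p : R) (A : set R) : measurable A ->
  mu [set y | A (y - p)] = mu A.
Proof.
move=> mA; rewrite -[LHS]/(pushforward mu (shift p) A).
apply/esym/lebesgue_measure_unique => //= _ [[a b]] _ <-.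
rewrite /pushforward (_ : _ @^-1` _ = `]a + p, b + p]%classic); last first.
  by apply/seteqP; split => x /=; rewrite !in_itv /= ltrBrDr lerBlDr.
rewrite !lebesgue_measure_itv /= !lte_fin ltrD2r.
by case: ifPn => // _; rewrite -!EFinB; congr EFin; ring.
Qed.

Lemma ge0_integral_shift (p : R) (D : set R) (f : R -> \bar R) : measurable D ->
  measurable_fun D f -> (forall y, 0 <= f y)%E ->
  (\int[mu]_(y in [set y | D (y - p)%R]) f (y - p)%R = \int[mu]_(y in D) f y)%E.
Proof.
move=> mD mf f0.
rewrite -[LHS](@ge0_integral_pushforward _ _ _ _ _ _ (measurable_shift p) mu D f) //.
by apply: eq_measure_integral => A mA _; exact: lebesgue_measure_shift.
Qed.

(** Supplies the majorant of the box kernels. Translation reduces to [p = 0], and evenness to the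
    known integral over the half line. *)
Lemma integrable_oneDsqrV (p : R) :
  mu.-integrable setT (EFin \o (fun y => (oneDsqr (y - p))^-1)).
Proof.
have m1 : measurable_fun [set: R] (fun y => (oneDsqr y)^-1).
  exact: continuous_measurable_fun (@continuous_oneDsqrV R).
have p1 (y : R) : 0 <= (oneDsqr y)^-1 by rewrite invr_ge0 ltW.
apply/integrableP; split.
  apply/measurable_EFinP; apply: (measurableT_comp m1).
  by apply: measurable_funB => //; exact: measurable_cst.
under eq_integral do rewrite /= ger0_norm //.
have -> : [set: R] = [set y | [set: R] (y - p)] by [].
rewrite (ge0_integral_shift p (f := fun y => (oneDsqr y)^-1%:E)) //; last first.
  exact/measurable_EFinP.
rewrite ge0_symfun_integralT //.
- rewrite (_ : [set x | _] = `[0, +oo[%classic); last first.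
    by apply/seteqP; split => x /=; rewrite in_itv /= andbT.
  by rewrite integral0y_oneDsqr -EFinM ltry.
- exact: continuous_oneDsqrV.
- by move=> x /=; rewrite /oneDsqr sqrrN.
Qed.

End Translation.

(** * Modulated boxes and their Fourier transforms *)

Section Waves.
Variable R : realType.
Local Notation mu := (@lebesgue_measure R).
Implicit Types (a b c p q y : R).

(** Plays two roles: on a unit interval it is a test vector ([box]), on [[-n, n]] it is the kernel
    of the truncated Fourier integral ([ftruncE]). *)
Definition wave a b p (x : R) : R[i] := (\1_`[a, b] x)%:C * expi (p * x).

Definition box c p := wave c (c + 1) p.

Lemma cnorm2_wave a b p x : cnorm2 (wave a b p x) = \1_`[a, b] x.
Proof.
rewrite /wave cnorm2M cnorm2_expi cnorm2_real mulr1 indicE.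
by case: (_ \in _); rewrite ?expr1n ?expr0n.
Qed.

Lemma integral_indic_itv (D : set R) a b : measurable D ->
  Rintegral mu D (\1_`[a, b] : R -> R) = fine (mu (`[a, b]%classic `&` D)).
Proof. by move=> mD; rewrite /Rintegral integral_indic. Qed.

Lemma L2_wave a b p : L2 (wave a b p).
Proof.
have mE : cmeasurable setT (fun x : R => expi (p * x)).
  have mL : measurable_fun setT (fun y : R => p * y).
    by apply: measurable_funM => //; exact: measurable_cst.
  split.
    rewrite (_ : _ \o _ = (fun x => cos (p * x))); last first.
      by apply/funext => x; rewrite [LHS]cre_expi.
    apply: (measurableT_comp _ mL).
    exact: continuous_measurable_fun (@continuous_cos R).
  rewrite (_ : _ \o _ = (fun x => sin (p * x))); last first.
    by apply/funext => x; rewrite [LHS]cim_expi.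
  apply: (measurableT_comp _ mL).
  exact: continuous_measurable_fun (@continuous_sin R).
have mI : cmeasurable setT (fun x : R => (\1_`[a, b] x)%:C).
  by split; [exact: measurable_indic|exact: measurable_cst].
have [m1 m2] := cmeasurableM mI mE; split; [exact: m1|split; [exact: m2|]].
under eq_integral do rewrite cnorm2_wave.
by rewrite integral_indic //= setIT lebesgue_measure_itv /=; case: ifP; rewrite ?ltry.
Qed.

Lemma inner_box c p : cre (inner (box c p) (box c p)) = 1.
Proof.
rewrite inner_self cre_real; under eq_Rintegral do rewrite cnorm2_wave.
rewrite integral_indic_itv // setIT lebesgue_measure_itv /= lte_fin ltrDl ltr01 /=.
by rewrite addrAC subrr add0r.
Qed.

Lemma cint_indic (D : set R) f : cint D f = cint setT (fun x => (\1_D x)%:C * f x).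
Proof.
apply: complex_ext; rewrite ?cre_cint ?cim_cint [LHS]Rintegral_mkcond;
  congr Rintegral; apply/funext => x; rewrite patchE /comp indicE ?creM ?cimM;
  by case: (_ \in _); rewrite ?cre_real ?cim_real ?mul1r ?mul0r ?subr0 ?addr0.
Qed.

Lemma ftruncE f (n : nat) y :
  ftrunc f n y = (Num.sqrt (pi *+ 2))^-1%:C * inner (wave (- n%:R) n%:R y) f.
Proof.
rewrite /ftrunc; congr (_ * _).
have H x : ((wave (- n%:R) n%:R y x)^* )%R * f x =
    (\1_`[- n%:R, n%:R] x)%:C * (f x * expi (- (x * y))).
  by rewrite /wave rmorphM /= conj_real expi_conj (mulrC y) -mulrA (mulrC (expi _)).
by rewrite cint_indic; congr cint; apply/funext => x; rewrite H.
Qed.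

(** The box lies inside [[a, b]], so the truncation does not affect it; the modulations combine to
    the frequency [y - p]. *)
Lemma inner_wave_box a b c y p : a <= c -> c + 1 <= b ->
  inner (wave a b y) (box c p) = box_kernel c (y - p).
Proof.
move=> ac cb; rewrite -cint_box_kernel /inner.
have H x : ((wave a b y x)^* )%R * box c p x =
    (\1_`[c, c + 1] x)%:C * expi (- (x * (y - p))).
  rewrite /box /wave rmorphM /= conj_real expi_conj !indicE !mem_setE !in_itv /=.
  have [xc|] := boolP (c <= x <= c + 1); last by rewrite /= rmorph0 !(mul0r, mulr0).
  have -> : a <= x <= b by lra.
  by rewrite /= rmorph1 !mul1r -expiD; congr expi; ring.
by rewrite [RHS]cint_indic; congr cint; apply/funext => x; rewrite H.
Qed.

Definition boxes (n : nat) (a c : nat -> R) p (x : R) : R[i] :=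
  \sum_(k < n) (a k)%:C * box (c k) p x.

Definition boxes_hat (n : nat) (a c : nat -> R) p (y : R) : R[i] :=
  (Num.sqrt (pi *+ 2))^-1%:C * \sum_(k < n) (a k)%:C * box_kernel (c k) (y - p).

Lemma L2_boxes n (a c : nat -> R) p : L2 (boxes n a c p).
Proof. by apply: (@L2_sum _ n (fun k => (a k)%:C) (fun k => box (c k) p)) => k;
  exact: L2_wave. Qed.

Lemma L2_boxes_hat n (a c : nat -> R) p : L2 (boxes_hat n a c p).
Proof.
apply: L2_scale.
apply: (@L2_sum _ n (fun k => (a k)%:C) (fun k y => box_kernel (c k) (y - p))) => k.
apply: (L2_dominated (cmeasurable_box_kernel (c k) p)
  (integrableZl measurableT 5 (integrable_oneDsqrV p))).
by move=> y; exact: cnorm2_box_kernel.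
Qed.

(** The boxes have bounded support, so the truncated integrals are eventually equal to [boxes_hat]
    and the error integral is eventually 0. *)
Lemma is_fourier_boxes n (a c : nat -> R) p : is_fourier (boxes n a c p) (boxes_hat n a c p).
Proof.
split; first exact: L2_boxes_hat.
(* A sum of bounds dominates each of them; the [+ 1] inside accounts for the right end [c k + 1] of
   a box. *)
pose N := (\sum_(k < n) (Num.truncn (`|c k| + 1)%R).+1)%N.
apply: cvg_near_cst.
exists N => // m /= Nm.
have ckm (k : 'I_n) : `|c k| + 1 <= m%:R.
  have h1 : `|c k| + 1 <= (Num.truncn (`|c k| + 1)%R).+1%:R by apply/ltW/truncnS_gt.
  apply: (le_trans h1); rewrite ler_nat; apply: leq_trans Nm.
  by rewrite /N (bigD1 k) //= leq_addr.
under eq_integral => y _.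
  rewrite ftruncE /boxes (@inner_sumr _ n (fun k => (a k)%:C) (fun k => box (c k) p)); last 2 first.
  - exact: L2_wave.
  - by move=> k; exact: L2_wave.
  rewrite (eq_bigr (fun k : 'I_n => (a k)%:C * box_kernel (c k) (y - p))); last first.
    move=> k _; congr (_ * _); rewrite inner_wave_box //.
    - by have := ckm k; have := ler_norm (- c k); rewrite normrN; lra.
    - by have := ckm k; have := ler_norm (c k); lra.
  rewrite subrr cnorm2_0; over.
by rewrite integral0.
Qed.

End Waves.

(** * Superoscillating polynomials *)

Section Superoscillation.
Variable R : realType.
Local Notation toC := (real_complex R).

(** Induction on [1 - (1 - v) ^+ m.+1 = v + (1 - v) * (1 - (1 - v) ^+ m)]. As [cnorm2 (1 - v) <= 4],
    the constant grows from [10 ^+ m] to at most [2 + 8 * 10 ^+ m <= 10 ^+ m.+1]. *)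
Lemma cnorm2_1B1BX (v : R[i]) (m : nat) : cnorm2 v <= 1 ->
  cnorm2 (1 - (1 - v) ^+ m) <= 10 ^+ m * cnorm2 v.
Proof.
move=> v1; elim: m => [|m IH].
  by rewrite expr0 subrr cnorm2_0 mul1r cnorm2_ge0.
have -> : 1 - (1 - v) ^+ m.+1 = v + (1 - v) * (1 - (1 - v) ^+ m) by rewrite exprS; ring.
apply: (le_trans (cnorm2D_le _ _)); rewrite cnorm2M exprS.
have h : cnorm2 (1 - v) <= 4.
  have := cnorm2D_le 1 (- v); rewrite [cnorm2 1]cnorm2_real.
  have -> : cnorm2 (- v) = cnorm2 v by rewrite /cnorm2 creN cimN !sqrrN.
  lra.
have h0 := cnorm2_ge0 (1 - v); have v0 := cnorm2_ge0 v.
have := ler_pM h0 (cnorm2_ge0 _) h IH.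
have := ler_peMl v0 (exprn_ege1 m (ler1n R 10)).
rewrite -!mulrA; move: (10 ^+ m * cnorm2 v) (_ * cnorm2 (1 - _ ^+ m)) => ? ?; lra.
Qed.

(* [S = (1 - (1 - X)^N)^m] is divisible by [X^m]; where [|1 - w| <= 1/2] the
   value [S(w)] tends to 1 as [N] grows. *)
Lemma superoscillation (b eta : R) : 0 < b -> 0 < eta ->
  exists (m : nat) (S : {poly R}), [/\ (0 < m)%N, forall k, (k < m)%N -> S`_k = 0 &
    forall s, `|s| <= b ->
      cnorm2 (1 - (map_poly toC S).[expi (- (2 / m%:R * s))]) <= eta].
Proof.
move=> b0 eta0; pose m := (Num.truncn (4 * b)).+1.
have mb : 4 * b < m%:R by exact: truncnS_gt.
pose N := (Num.truncn (10 ^+ m / eta)).+1.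
have Nb : 10 ^+ m / eta < N%:R by exact: truncnS_gt.
exists m, ((1 - (1 - 'X) ^+ N) ^+ m); split => //.
  move=> k km; have : root (1 - (1 - 'X) ^+ N : {poly R}) 0.
    by rewrite /root !hornerE subr0 expr1n subrr.
  move=> /factor_theorem[h ->]; rewrite subr0 exprMn coefMXn km //.
move=> s sb; set w := expi _.
have -> : (map_poly toC ((1 - (1 - 'X) ^+ N) ^+ m)).[w] = (1 - (1 - w) ^+ N) ^+ m.
  by rewrite !(rmorphXn, rmorphB, rmorph1) /= map_polyX !hornerE.
have m0 : 0 < m%:R :> R by rewrite ltr0n.
have z4 : cnorm2 (1 - w) <= 4^-1.
  apply: (le_trans (cnorm2_expi_sub1 _)); rewrite sqrrN exprMn.
  have -> : 4^-1 = (2 / m%:R) ^+ 2 * (m%:R / 4) ^+ 2 :> R by field; lra.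
  rewrite ler_pM2l; last by rewrite exprn_gt0 // divr_gt0.
  rewrite -[s ^+ 2](real_normK (num_real s)) ler_sqr ?nnegrE ?divr_ge0 //; lra.
have zN : cnorm2 ((1 - w) ^+ N) <= (4^-1) ^+ N.
  elim: (N) => [|j IH]; first by rewrite !expr0 [cnorm2 1]cnorm2_real expr1n.
  by rewrite !exprS cnorm2M ler_pM ?cnorm2_ge0.
have N4 : (4^-1) ^+ N <= N%:R^-1 :> R.
  rewrite exprVn lef_pV2 ?posrE ?exprn_gt0 ?ltr0n //.
  by rewrite -natrX ler_nat ltnW // ltn_expl.
apply: (le_trans (cnorm2_1B1BX _ _)).
  by rewrite (le_trans zN) // exprn_ile1 //; lra.
have Ninv : 10 ^+ m * N%:R^-1 <= eta.
  rewrite ler_pdivrMr ?ltr0n // -ler_pdivrMl // mulrC; exact: ltW.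
by apply: (le_trans _ Ninv); rewrite ler_pM2l ?exprn_gt0 // (le_trans zN).
Qed.

End Superoscillation.

Section EscapingInterval.
Variable R : realType.

Lemma probability_escape (nu : probability R R) (L eps : R) : 0 < eps ->
  exists q : R, fine (nu `[q, q + L]%classic) <= eps.
Proof.
move=> eps0; pose F (n : nat) : set R := `[n%:R, +oo[%classic.
have F0 : \bigcap_n F n = set0.
  apply/seteqP; split => // x /(_ (Num.truncn x).+1 Logic.I).
  by rewrite /F /= in_itv /= andbT leNgt truncnS_gt.
have : (nu \o F) n @[n --> \oo] --> nu (\bigcap_n F n).
  apply: nonincreasing_cvg_mu => //.
  - by apply: le_lt_trans (probability_le1 _ _) _; rewrite ?ltry //; exact: measurable_itv.
  - by move=> i; exact: measurable_itv.
  - by rewrite F0; exact: measurable0.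
  - move=> i j ij; apply/subsetPset => x; rewrite /F /= !in_itv /= !andbT.
    by apply: le_trans; rewrite ler_nat.
rewrite F0 measure0 => /fine_cvgP[_] /cvgrPdist_le /(_ _ eps0)[n _ /(_ n (leqnn n))].
rewrite /= sub0r normrN => Fn; exists n%:R; apply: le_trans (ler_norm _) _.
apply: le_trans Fn; rewrite !ger0_norm ?fine_ge0 //.
apply: fine_le; rewrite ?fin_num_measure //.
  by apply: measurable_itv.
apply: le_measure; rewrite ?inE //; do ?exact: measurable_itv.
by move=> x; rewrite /F /= !in_itv /= andbT => /andP[].
Qed.

End EscapingInterval.

Section MomentumMass.
Variable R : realType.
Local Notation mu := (@lebesgue_measure R).
Local Notation toC := (real_complex R).
Implicit Types (T : {poly R}) (n : nat) (q p delta y s : R).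

Definition box_density s : R :=
  cnorm2 ((Num.sqrt (pi *+ 2))^-1%:C * box_kernel 0 s).

Definition poly_boxes n T q delta p : R -> R[i] :=
  boxes n (fun k => T`_k) (fun k => q + k%:R * delta) p.

Definition poly_boxes_hat n T q delta p : R -> R[i] :=
  boxes_hat n (fun k => T`_k) (fun k => q + k%:R * delta) p.

Lemma poly_boxes1 n q delta p : (0 < n)%N -> poly_boxes n 1 q delta p = box q p.
Proof.
case: n => // n _; apply/funext => x; rewrite /poly_boxes /boxes big_ord_recl big1.
  by rewrite addr0 coef1 /= mul0r addr0 rmorph1 mul1r.
by move=> i _; rewrite coef1 /= rmorph0 mul0r.
Qed.

Lemma poly_boxesD n T1 T2 q delta p x :
  poly_boxes n (T1 + T2) q delta p x =
  poly_boxes n T1 q delta p x + poly_boxes n T2 q delta p x.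
Proof.
rewrite /poly_boxes /boxes -big_split /=; apply: eq_bigr => k _.
by rewrite coefD rmorphD mulrDl.
Qed.

Lemma cnorm2_poly_boxes_hat n T q delta p y : (size T <= n)%N ->
  cnorm2 (poly_boxes_hat n T q delta p y) =
  cnorm2 (map_poly toC T).[expi (- (delta * (y - p)))] * box_density (y - p).
Proof.
move=> Tn; rewrite /poly_boxes_hat /boxes_hat /box_density.
set w := expi _; set s := y - p.
have -> : \sum_(k < n) (T`_k)%:C * box_kernel (q + k%:R * delta) s =
    (map_poly toC T).[w] * box_kernel q s.
  rewrite (@horner_coef_wide _ n) ?size_map_poly // mulr_suml.
  apply: eq_bigr => k _; rewrite coef_map /= box_kernel_shift mulrA.
  by rewrite -[w ^+ k]expi_natmul mulrN mulrA.
rewrite -[q in box_kernel q s]add0r box_kernel_shift !cnorm2M cnorm2_expi.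
by rewrite mul1r mulrCA.
Qed.

Lemma cnorm2_box_hat n q delta p y : (0 < n)%N ->
  cnorm2 (poly_boxes_hat n 1 q delta p y) = box_density (y - p).
Proof.
move=> n0; rewrite cnorm2_poly_boxes_hat ?size_poly1 //.
by rewrite rmorph1 hornerC [cnorm2 1]cnorm2_real expr1n mul1r.
Qed.

Lemma integrable_box_density p :
  mu.-integrable setT (EFin \o (fun y => box_density (y - p))).
Proof.
have := L2_integrable (L2_boxes_hat 1 (fun k => (1 : {poly R})`_k)
  (fun k => 0 + k%:R * 0) p).
rewrite (_ : (fun y => _) = (fun y => box_density (y - p))) //.
by apply/funext => y; rewrite -(@cnorm2_box_hat 1 0 0).
Qed.

Lemma box_density_ge0 s : 0 <= box_density s.
Proof. exact: cnorm2_ge0. Qed.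

Lemma integral_box_density_shift b p :
  Rintegral mu `[p - b, p + b] (fun y => box_density (y - p)) =
  Rintegral mu `[- b, b] box_density.
Proof.
congr fine; rewrite -(ge0_integral_shift p (D := `[- b, b]%classic)
  (f := fun s => (box_density s)%:E)) //.
- congr integral; apply/seteqP; split => x /=; rewrite !in_itv /=; lra.
- have := measurable_int _ (integrable_box_density 0).
  rewrite (_ : _ \o _ = EFin \o box_density); last first.
    by apply/funext => x /=; rewrite subr0.
  by apply: measurable_funS.
- by move=> y; rewrite lee_fin box_density_ge0.
Qed.

Lemma box_density_concentrated (eta : R) : 0 < eta ->
  exists2 b : R, 0 < b &
    Rintegral mu setT box_density - eta <= Rintegral mu `[- b, b] box_density.
Proof.
move=> eta0; pose F (n : nat) : set R := `[- n%:R, n%:R]%classic.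
have I0 : mu.-integrable setT (EFin \o box_density).
  have := integrable_box_density 0.
  by rewrite (_ : (fun y => _) = box_density) //; apply/funext => y; rewrite subr0.
have UF : \bigcup_n F n = setT.
  apply/seteqP; split => // x _; exists (Num.truncn `|x|).+1 => //.
  by rewrite /F /= in_itv /= -ler_norml ltW // truncnS_gt.
have mI := measurable_int _ I0.
have : (\int[mu]_(x in F n) (box_density x)%:E)%E @[n --> \oo] -->
    (\int[mu]_(x in \bigcup_n F n) (box_density x)%:E)%E.
  apply: ge0_nondecreasing_set_cvg_integral => //.
  - move=> i j ij; apply/subsetPset => x; rewrite /F /= !in_itv /= -!ler_norml.
    by move=> /le_trans; apply; rewrite ler_nat.
  - by move=> i; exact: measurable_itv.
  - by move=> i; apply: measurable_funS mI.
  - by move=> i x _; rewrite lee_fin box_density_ge0.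
rewrite UF -[X in _ --> X]fineK; last by apply: integrable_fin_num.
move=> /fine_cvg /cvgrPdist_le /(_ _ eta0)[n _ /(_ n.+1 (leqnSn n))] /=.
rewrite ler_norml => /andP[_ h]; exists n.+1%:R; rewrite ?ltr0n //.
by rewrite lerBlDr -lerBlDl.
Qed.

End MomentumMass.

Section NecessaryCondition.
Variable R : realType.
Local Notation mu := (@lebesgue_measure R).
Local Notation toC := (real_complex R).

Lemma op_form_aeq (A B : op R) f : L2 f -> L2 (A f) -> L2 (B f) ->
  aeq (A f) (B f) -> op_form A f = op_form B f.
Proof. by move=> f2 Af2 Bf2 AB; rewrite /op_form (inner_aeqr f2 Af2 Bf2 AB). Qed.

Lemma L2_mix (d : measure_display) (T : measurableType d) (M : set T -> op R) (lam : R)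
    (nu : probability T R) X f : observable M -> measurable X -> L2 f ->
  L2 (mix lam M (triv_obs nu) X f).
Proof.
move=> oM mX f2; apply: L2_lin; last by apply: L2_scale; exact: L2_scale.
exact: (bounded_linear_L2 (observable_bounded oM mX)).
Qed.

Lemma box_indicator_disjoint (q c p : R) : q + 1 < c ->
  Rintegral mu `[q, q + 1] (fun x => cnorm2 (box c p x)) = 0.
Proof.
move=> qc; under eq_Rintegral do rewrite cnorm2_wave.
rewrite integral_indic_itv // (_ : _ `&` _ = set0) ?measure0 //.
by apply/seteqP; split => // x [] /=; rewrite !in_itv /=; lra.
Qed.

Variables (Q P : set R -> op R) (lam m : R).
Variables (nu1 nu2 : probability R R) (M : set (R * R) -> op R).
Hypotheses (oQ : observable Q) (oP : observable P) (oM : observable M).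
Hypothesis formQ : forall X : set R, measurable X -> forall f, L2 f ->
  op_form (Q X) f = Rintegral mu X (fun x => cnorm2 (f x)).
Hypothesis formP : forall Y : set R, measurable Y -> forall f phi, L2 f ->
  is_fourier f phi -> op_form (P Y) f = Rintegral mu Y (fun y => cnorm2 (phi y)).
Hypotheses (lam01 : 0 <= lam <= 1) (m01 : 0 <= m <= 1).
Hypothesis M1 : forall X, measurable X -> forall f, L2 f ->
  aeq (M (X `*` setT) f) (mix lam Q (triv_obs nu1) X f).
Hypothesis M2 : forall Y, measurable Y -> forall f, L2 f ->
  aeq (M (setT `*` Y) f) (mix m P (triv_obs nu2) Y f).

Let joint_form1 (X : set R) f : measurable X -> L2 f ->
  op_form (M (X `*` setT)) f =
  lam * op_form (Q X) f + (1 - lam) * fine (nu1 X) * cre (inner f f).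
Proof.
move=> mX f2; rewrite -op_form_mix //; apply: op_form_aeq => //.
- by apply: (bounded_linear_L2 (observable_bounded oM _)) => //; exact: measurableX.
- exact: L2_mix.
- exact: M1.
Qed.

Let joint_form2 (Y : set R) f : measurable Y -> L2 f ->
  op_form (M (setT `*` Y)) f =
  m * op_form (P Y) f + (1 - m) * fine (nu2 Y) * cre (inner f f).
Proof.
move=> mY f2; rewrite -op_form_mix //; apply: op_form_aeq => //.
- by apply: (bounded_linear_L2 (observable_bounded oM _)) => //; exact: measurableX.
- exact: L2_mix.
- exact: M2.
Qed.

Let form_poly n (T : {poly R}) q delta p (Y : set R) : measurable Y -> (size T <= n)%N ->
  op_form (P Y) (poly_boxes n T q delta p) = Rintegral mu Y (fun y =>
    cnorm2 (map_poly toC T).[expi (- (delta * (y - p)))] * box_density (y - p)).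
Proof.
move=> mY Tn.
rewrite (formP mY (L2_boxes _ _ _ _) (is_fourier_boxes n _ _ p)).
by apply: eq_Rintegral => y _; exact: cnorm2_poly_boxes_hat.
Qed.

Let form_box (Y : set R) q p : measurable Y ->
  op_form (P Y) (box q p) = Rintegral mu Y (fun y => box_density (y - p)).
Proof.
move=> mY; rewrite -(@poly_boxes1 _ 1 q 0) // form_poly ?size_poly1 //.
apply: eq_Rintegral => y _.
by rewrite rmorph1 hornerC [cnorm2 1]cnorm2_real expr1n mul1r.
Qed.

Let density_mass p : Rintegral mu setT (fun y => box_density (y - p)) = 1.
Proof.
rewrite -(form_box 0) // observable_formT //; last exact: L2_wave.
exact: inner_box.
Qed.

Lemma joint_form_lower (X Y : set R) f : measurable X -> measurable Y -> L2 f ->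
  op_form (M (X `*` setT)) f + op_form (M (setT `*` Y)) f <=
  cre (inner f f) + op_form (M (X `*` Y)) f.
Proof.
move=> mX mY f2.
have mXY : measurable (X `*` Y) by exact: measurableX.
have mXT : measurable (X `*` [set: R]) by exact: measurableX.
have mCY : measurable (~` X `*` Y) by apply: measurableX => //; exact: measurableC.
have -> : setT `*` Y = (X `*` Y) `|` (~` X `*` Y).
  apply/seteqP; split => [[x y] [_ Yy]|[x y] [] [] //].
  by have [Xx|nXx] := pselect (X x); [left|right].
rewrite (observable_formU oM mXY mCY) //; last first.
  by apply/seteqP; split => // -[x y] [[/= Xx _] [/= nXx _]].
rewrite addrCA [leRHS]addrC lerD2l -(observable_formU oM mXT mCY) //; last first.
  by apply/seteqP; split => // -[x y] [[/= Xx _] [/= nXx _]].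
rewrite -(observable_formT oM f2); apply: observable_form_le => //.
exact: measurableU.
Qed.

Lemma joint_weights_le_eta (eta : R) : 0 < eta -> lam + m <= 1 + 7 * eta.
Proof.
move=> eta0; have [lam_ge0 lam_le1] := andP lam01; have [m_ge0 m_le1] := andP m01.
have [b b0 hb] := box_density_concentrated eta0.
have [k0 [S [k00 S0 Seta]]] := superoscillation b0 eta0.
pose delta : R := 2 / k0%:R; pose D := 1 - S.
pose n := (maxn (size S) (size D)).+1.
have nS : (size S <= n)%N by rewrite leqW // leq_maxl.
have nD : (size D <= n)%N by rewrite leqW // leq_maxr.
pose C : R := 2 ^+ n * \sum_(k < n) (S`_k ^+ 2 + D`_k ^+ 2).
have C0 : 0 <= C.
  by rewrite mulr_ge0 ?exprn_ge0 // sumr_ge0 // => k _; rewrite addr_ge0 ?sqr_ge0.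
pose eps := eta / (C + 1).
have C1 : 0 < C + 1 by lra.
have eps0 : 0 < eps by rewrite divr_gt0.
have epsC : eps * C <= eta.
  rewrite /eps mulrAC ler_pdivrMr //; have := mulr_ge0 (ltW eta0) C0; lra.
have [q hq] := probability_escape nu1 1 eps0.
have [p' hp'] := probability_escape nu2 (2 * b) eps0.
pose p := p' + b; pose X : set R := `[q, q + 1]%classic.
pose Y : set R := `[p - b, p + b]%classic.
have mX : measurable X by exact: measurable_itv.
have mY : measurable Y by exact: measurable_itv.
have hX : fine (nu1 X) <= eps by [].
have hY : fine (nu2 Y) <= eps.
  apply: le_trans hp'; rewrite /Y (_ : p - b = p'); last by rewrite /p; ring.
  by rewrite (_ : p + b = p' + 2 * b) //; rewrite /p; ring.
have nu10 : 0 <= fine (nu1 X) by rewrite fine_ge0.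
have nu20 : 0 <= fine (nu2 Y) by rewrite fine_ge0.
pose comb T := poly_boxes n T q delta p; pose u (k : nat) := box (q + k%:R * delta) p.
have u2 k : L2 (u k) by exact: L2_wave.
have comb2 T : L2 (comb T) by exact: L2_boxes.
have psi2 : L2 (box q p) by exact: L2_wave.
have mXY : measurable (X `*` Y) by exact: measurableX.
have mXT : measurable (X `*` [set: R]) by exact: measurableX.
have mTY : measurable ([set: R] `*` Y) by exact: measurableX.
have bM := observable_bounded oM mXY; have pM := observable_positive oM mXY.
have IY : mu.-integrable Y (EFin \o (fun y => box_density (y - p))).
  by apply: (integrableS _ _ _ (integrable_box_density p)) => //; exact: mY.
have massY : Rintegral mu Y (fun y => box_density (y - p)) <= 1.
  rewrite -(density_mass p) /Rintegral; apply: fine_le.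
  - by apply: integrable_fin_num.
  - by apply: integrable_fin_num => //; exact: integrable_box_density.
  - apply: ge0_subset_integral => //.
    + exact: measurable_int (integrable_box_density p).
    + by move=> y _; rewrite lee_fin box_density_ge0.
have massY' : 1 - eta <= Rintegral mu Y (fun y => box_density (y - p)).
  rewrite integral_box_density_shift; apply: le_trans hb.
  rewrite -(density_mass 0) (_ : (fun y => box_density (y - 0)) = @box_density R) //.
  by apply/funext => y; rewrite subr0.
have combC (T : {poly R}) : 2 ^+ n * (\sum_(k < n) T`_k ^+ 2) <= C ->
    cre (inner (comb T) (comb T)) <= C.
  apply: le_trans.
  have := op_form_sum_le n (fun k => T`_k) (@bounded_linear_id R)
    (@positive_op_id R) u2.
  rewrite (eq_bigr (fun k : 'I_n => T`_k ^+ 2)) // => k _.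
  by rewrite /op_form /u inner_box mulr1.
have CS : 2 ^+ n * (\sum_(k < n) S`_k ^+ 2) <= C.
  rewrite ler_wpM2l ?exprn_ge0 //; apply: ler_sum => k _.
  by rewrite lerDl sqr_ge0.
have CD : 2 ^+ n * (\sum_(k < n) D`_k ^+ 2) <= C.
  rewrite ler_wpM2l ?exprn_ge0 //; apply: ler_sum => k _.
  by rewrite lerDr sqr_ge0.
(* far translates carry almost no joint probability, since Q(X) kills them *)
have eS : op_form (M (X `*` Y)) (comb S) <= eta.
  have := op_form_sum_le n (fun k => S`_k) bM pM u2.
  move=> /le_trans; apply; apply: le_trans epsC; rewrite [leRHS]mulrC.
  apply: le_trans (ler_wpM2r (ltW eps0) CS).
  rewrite -mulrA ler_wpM2l ?exprn_ge0 // mulr_suml; apply: ler_sum => k _.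
  have [kk0|kk0] := ltnP k k0; first by rewrite S0 // expr0n /= !mul0r.
  rewrite ler_wpM2l ?sqr_ge0 //.
  apply: le_trans (observable_form_le oM mXY mXT _ (u2 k)) _.
    by move=> [x y] [].
  rewrite joint_form1 // (formQ mX (u2 k)) box_indicator_disjoint.
    rewrite mulr0 add0r inner_box mulr1.
    by have := mulr_ge0 lam_ge0 nu10; lra.
  rewrite ltrD2l /delta mulrA ltr_pdivlMr ?ltr0n // mul1r -natrM ltr_nat muln2.
  by rewrite -addnn (leq_ltn_trans kk0) // -[ltnLHS]addn0 ltn_add2l (leq_trans k00).
have eD : op_form (M (X `*` Y)) (comb D) <= 2 * eta.
  apply: le_trans (observable_form_le oM mXY mTY _ (comb2 D)) _.
    by move=> [x y] [].
  rewrite joint_form2 // form_poly //.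
  have h1 : Rintegral mu Y (fun y =>
      cnorm2 (map_poly toC D).[expi (- (delta * (y - p)))] * box_density (y - p))
      <= eta.
    apply: (@le_trans _ _ (Rintegral mu Y (fun y => eta * box_density (y - p)))).
      apply: le_Rintegral => //.
      - rewrite (_ : (fun y => _) = fun y => cnorm2 (poly_boxes_hat n D q delta p y)).
          have I2 := L2_integrable (L2_boxes_hat n (fun k => D`_k)
            (fun k => q + k%:R * delta) p).
          by apply: (integrableS _ _ _ I2) => //; exact: mY.
        by apply/funext => y; rewrite cnorm2_poly_boxes_hat.
      - exact: (integrableZl _ eta IY).
      - move=> y; rewrite /Y /= in_itv /= => yY.
        rewrite ler_wpM2r ?box_density_ge0 // /D rmorphB rmorph1 hornerD hornerN hornerC.
        by apply: Seta; rewrite ler_norml; lra.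
    by rewrite RintegralZl //; have := ler_wpM2l (ltW eta0) massY; lra.
  have h2 := combC D CD; have h20 := inner_self_ge0 (comb D).
  have h3 : fine (nu2 Y) * cre (inner (comb D) (comb D)) <= eta.
    by apply: le_trans epsC; exact: ler_pM.
  have h30 := mulr_ge0 nu20 h20.
  rewrite -mulrA; move: h1 h3 h30; set I1 := Rintegral _ _ _; set I2 := _ * cre _.
  have I10 : 0 <= I1.
    by apply: Rintegral_ge0 => y _; rewrite mulr_ge0 ?cnorm2_ge0 ?box_density_ge0.
  move=> h1 h3 h30; have := ler_piMl I10 m_le1; have := mulr_ge0 m_ge0 h30; lra.
have epsi : op_form (M (X `*` Y)) (box q p) <= 6 * eta.
  have := op_formD_le bM pM (comb2 S) (comb2 D).
  rewrite (_ : (fun x => _) = box q p); first by lra.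
  apply/funext => x; rewrite -poly_boxesD /D addrC subrK.
  by rewrite poly_boxes1.
have := joint_form_lower mX mY psi2.
rewrite joint_form1 // joint_form2 // form_box // (formQ mX psi2) inner_box.
have -> : Rintegral mu X (fun x => cnorm2 (box q p x)) = 1.
  under eq_Rintegral do rewrite cnorm2_wave.
  rewrite integral_indic_itv // setIid lebesgue_measure_itv /= lte_fin ltrDl ltr01 /=.
  by rewrite addrAC subrr add0r.
have lamC : 0 <= 1 - lam by lra.
have mC : 0 <= 1 - m by lra.
have := mulr_ge0 lamC nu10; have := mulr_ge0 mC nu20.
have := ler_wpM2l m_ge0 massY'; have := ler_piMl (ltW eta0) m_le1; lra.
Qed.

Lemma joint_weights_le : lam + m <= 1.
Proof.
apply/ler_addgt0Pr => e e0; have e7 : 0 < e / 7 by rewrite divr_gt0.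
by have := joint_weights_le_eta e7; lra.
Qed.

End NecessaryCondition.

Theorem theorem2 (R : realType) (Q P : set R -> op R) :
  observable Q -> observable P ->
  (forall X : set R, measurable X -> forall psi, L2 psi ->
     inner psi (Q X psi) = (Rintegral (@lebesgue_measure R) X (fun x => cnorm2 (psi x)))%:C) ->
  (forall Y : set R, measurable Y -> forall psi phi, L2 psi -> is_fourier psi phi ->
     inner psi (P Y psi) = (Rintegral (@lebesgue_measure R) Y (fun y => cnorm2 (phi y)))%:C) ->
  jm_region Q P = [set p : R * R | 0 <= p.1 /\ 0 <= p.2 /\ p.1 + p.2 <= 1].
Proof.
move=> oQ oP hQ hP; apply/seteqP; split => -[lam m] /=; last first.
  by move=> [lam0 [m0 lm1]]; exact: jm_region_triangle.
move=> [/= lam01 [m01 [nu1 [nu2 [M [oM [M1 M2]]]]]]].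
split; [by case/andP: lam01|split; [by case/andP: m01|]].
apply: (joint_weights_le oQ oP oM _ _ lam01 m01 M1 M2).
  by move=> X mX f f2; rewrite /op_form hQ.
by move=> Y mY f phi f2 fphi; rewrite /op_form (hP Y mY f phi).
Qed.
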